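(* Let $m=bu^2$ where $b\ge 1$ is a square-free integer and $u>1$ is an integer. Then $s_m(x)$ can be expressed as a finite linear combination of functions of the form \[ w(b,t)\,\sec(btx)\bigl(\sigma\cos((b-p)tx)+\tau\sin(ptx)\bigr), \] where $\sigma,\tau\in\{1,-1\}$, $p$ is an integer with $0\le p\le b$, $t$ is a positive divisor of $u^2$, and $w(b,t)=K_b\,t/u$.
   Context: For an integer $a$ and odd positive integer $l$, $\left(\frac{a}{l}\right)$ denotes the Jacobi symbol. For a positive integer $m$ define the Dirichlet series $L_m(s)=\sum_{l>0,\ l \text{ odd}}\left(\frac{-m}{l}\right) l^{-s}$ and $L_{-m}(s)=\sum_{l>0,\ l\text{ odd}}\left(\frac{m}{l}\right) l^{-s}$. Let $K_m=\tfrac12$ if $m=1$ and $K_m=1$ otherwise. Define $c_{m,n}=(2n)!\,L_m(2n+1)\,(K_m\sqrt m)^{-1}\left(\frac{\pi}{2m}\right)^{-2n-1}$ for $n\ge 0$ and $d_{m,n}=(2n-1)!\,L_{-m}(2n)\,(K_m\sqrt m)^{-1}\left(\frac{\pi}{2m}\right)^{-2n}$ for $n\ge1$. The generalized Euler and class numbers are $s_{m,n}=c_{m,n/2}$ for $n$ even and $s_{m,n}=d_{m,(n+1)/2}$ for $n$ odd, and $s_m(x)=\sum_{n\ge0}s_{m,n}\frac{x^n}{n!}$ (identities are as power series in $x$, equivalently analytic functions near $x=0$). *)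

(* Defs.v *)
From HB Require Import structures.
From mathcomp Require Import all_boot all_order all_algebra.
From mathcomp Require Import all_classical all_reals all_analysis.
Set Implicit Arguments.
Unset Strict Implicit.
Unset Printing Implicit Defensive.
Import Order.TTheory GRing.Theory Num.Theory.
Import numFieldNormedType.Exports.
Local Open Scope ring_scope.

Definition squarefree (b : nat) : Prop :=
  forall d : nat, (d ^ 2 %| b)%N -> d = 1%N.

(* Meaningful for p an odd prime. *)
Definition legendre (a : int) (p : nat) : int :=
  if (p%:Z %| a)%Z then 0
  else if [exists x : 'I_p, (p%:Z %| (x : nat)%:Z ^+ 2 - a)%Z] then 1
  else -1.

(* Meaningful for l odd and positive. *)
Definition jacobi (a : int) (l : nat) : int :=
  \prod_(q <- prime_decomp l) legendre a q.1 ^+ q.2.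

Section GeneralizedEulerClassNumbers.
Variable R : realType.

(* [Lser a s] is L_a(s) for a : int of either sign: L_m uses the symbol (-m / l)
   and L_{-m} uses (m / l).  Only integer arguments s >= 1 are needed.  The
   limit of partial sums, in increasing order of l, matters at s = 1, where
   convergence is only conditional. *)
Definition Lser (a : int) (s : nat) : R :=
  limn (fun N : nat =>
    \sum_(1 <= l < N | odd l) (jacobi (- a) l)%:~R * l%:R ^- s : R).

Definition Kc (m : nat) : R := if m == 1%N then 2^-1 else 1.

Definition cnum (m n : nat) : R :=
  (n.*2)`!%:R * Lser m%:Z n.*2.+1 * (Kc m * Num.sqrt m%:R)^-1
    * (pi / (2 * m%:R)) ^- n.*2.+1.

(* Only used for n >= 1. *)
Definition dnum (m n : nat) : R :=
  (n.*2.-1)`!%:R * Lser (- m%:Z) n.*2 * (Kc m * Num.sqrt m%:R)^-1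
    * (pi / (2 * m%:R)) ^- n.*2.

Definition snum (m n : nat) : R :=
  if odd n then dnum m n.+1./2 else cnum m n./2.

Definition sec (x : R) : R := (cos x)^-1.

Definition wgt (b u t : nat) : R := Kc b * t%:R / u%:R.

Definition basic_fun (b u : nat) (f : R -> R) : Prop :=
  exists (sigma tau : R) (p t : nat),
    [/\ (sigma = 1 \/ sigma = -1) /\ (tau = 1 \/ tau = -1),
        (p <= b)%N,
        (0 < t)%N /\ (t %| u ^ 2)%N &
        f = fun x => wgt b u t * sec (b%:R * t%:R * x)
              * (sigma * cos ((b - p)%N%:R * t%:R * x)
                 + tau * sin (p%:R * t%:R * x))].

End GeneralizedEulerClassNumbers.

(* Main.v *)
Require Import Defs.
From HB Require Import structures.
From mathcomp Require Import all_boot all_order all_algebra.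
From mathcomp Require Import finfield.
From mathcomp Require Import all_classical all_reals all_analysis.
From mathcomp Require Import zify ring lra.
Set Implicit Arguments.
Unset Strict Implicit.
Unset Printing Implicit Defensive.
Import Order.TTheory GRing.Theory Num.Theory.
Import numFieldNormedType.Exports.
Local Open Scope classical_set_scope.
Local Open Scope ring_scope.

(** Since [m = b u^2], the character of [m] is that of [b] times the indicator
    of being coprime to [u], and the latter is a combination of the indicators
    of [d | l] with [d | u]; hence the series of [m] is a combination of the
    series of [b] evaluated at [t x] with [t = u^2 / d].  By quadratic
    reciprocity the character of [+b] or [-b] on odd [l] is periodic modulo
    [4b], and it is respectively even or odd.  Summing the geometric series in
    [x] turns the generating function of its L-values into the symmetric sum of
    [g l / (l - z)] over all integers [l], with [z = 2 b x / pi], which the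
    partial fractions of the cotangent turn into a finite combination of
    [cot (pi r / 4b - x / 2)], [r] odd.  The poles of these cotangents are
    zeros of [cos (b x)], so that multiplying by [cos (b x)] leaves
    trigonometric polynomials of degree at most [b].  As the coefficients of
    the combination are arbitrary reals, no Gauss sum has to be evaluated. *)

(** * Quadratic reciprocity and periodicity of the Jacobi symbol *)

Lemma intr_Fp_eq0 (p : nat) (a : int) : prime p ->
  (a%:~R == 0 :> 'F_p) = (p%:Z %| a)%Z.
Proof.
move=> pp; rewrite dvdzE /=.
have [|n|n] := intP a; first by rewrite mulr0z eqxx dvdn0.
  by rewrite (dvdn_pcharf (pchar_Fp pp)).
by rewrite abszN rmorphN /= oppr_eq0 (dvdn_pcharf (pchar_Fp pp)).
Qed.

Lemma natr_Fp_eq0 (p : nat) (a : nat) : prime p ->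
  (a%:R == 0 :> 'F_p) = (p %| a)%N.
Proof. by move=> pp; rewrite (dvdn_pcharf (pchar_Fp pp)). Qed.

Lemma half_pred_odd p : odd p -> p = (p./2).*2.+1.
Proof. by move=> op; rewrite -[LHS]odd_double_half op. Qed.

Lemma expf_half_sqr (p : nat) (x : 'F_p) : prime p -> odd p -> x != 0 ->
  (x ^+ p./2) ^+ 2 = 1.
Proof.
move=> pp op x0; apply: (mulfI x0).
rewrite -exprM muln2 -exprS -half_pred_odd // mulr1.
by rewrite -[in RHS](expf_card x) card_Fp.
Qed.

Lemma natr_Fp_inj (p i j : nat) : prime p -> (i < p)%N -> (j < p)%N ->
  i%:R = j%:R :> 'F_p -> i = j.
Proof.
move=> pp ip jp; wlog: i j ip jp / (i <= j)%N.
  by move=> W e; have [h|h] := leqP i j; [exact: W | apply/esym/W => //; exact: ltnW].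
move=> ij e; have : (j - i)%:R = 0 :> 'F_p by rewrite natrB // e subrr.
by move/eqP; rewrite natr_Fp_eq0 // => /dvdnP[[|k]]; nia.
Qed.

Lemma natr_Fp_opp_eq (p i j : nat) : prime p -> odd p ->
  (i < p./2)%N -> (j < p./2)%N -> i.+1%:R = - j.+1%:R :> 'F_p -> False.
Proof.
move=> pp op ip jp /eqP; rewrite -addr_eq0 -natrD natr_Fp_eq0 // => /dvdn_leq; lia.
Qed.

(** The squares of 1, ..., (p-1)/2 are distinct roots of X^((p-1)/2) - 1, as many as its degree; a
    root [x] outside them would be one too many. *)
Lemma Fp_square_of_exp (p : nat) (x : 'F_p) : prime p -> odd p ->
  x ^+ p./2 = 1 -> exists y : 'I_p, x = (y : nat)%:R ^+ 2.
Proof.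
move=> pp op xh.
have [y /eqP ->|nsq] := pickP (fun y : 'I_p./2 => x == (y.+1)%:R ^+ 2).
  have yp : (y.+1 < p)%N by have := ltn_ord y; lia.
  by exists (Ordinal yp).
pose l : seq 'F_p := [seq (nat_of_ord i).+1%:R ^+ 2 | i <- enum 'I_p./2].
pose s := x :: l.
have p2 := prime_gt1 pp.
pose q : {poly 'F_p} := 'X^(p./2) - 1%:P.
have sq : size q = p./2.+1 by rewrite size_XnsubC //; lia.
have := @max_poly_roots _ q s.
rewrite sq /s /= size_map size_enum_ord ltnn.
have q0 : q != 0 by rewrite -size_poly_eq0 sq.
suff [-> ->] : x \notin l /\ uniq l.
  move=> /(_ q0) H; suff: false by []. apply: H => //.
  rewrite rootE !hornerE xh subrr eqxx /=.
  apply/allP => _ /mapP[i _ ->].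
  rewrite rootE !hornerE -exprM mulnC exprM expf_half_sqr ?subrr //.
  rewrite natr_Fp_eq0 //; apply/negP => /dvdn_leq; have := ltn_ord i; lia.
split; first by apply/mapP => -[i _ e]; have := nsq i; rewrite e eqxx.
rewrite map_inj_uniq ?enum_uniq // => i j /eqP; rewrite eqf_sqr => /orP[] /eqP.
  have := ltn_ord i; have := ltn_ord j => h1 h2.
  by move/(natr_Fp_inj pp) => H; apply/ord_inj/succn_inj/H; lia.
by move/(natr_Fp_opp_eq pp op (ltn_ord i) (ltn_ord j)).
Qed.

(** Euler's criterion: for [a] nonzero modulo [p] the power squares to 1, and by [Fp_square_of_exp]
    it equals 1 only if [a] is a square. *)
Lemma legendreE (p : nat) (a : int) : prime p -> odd p ->
  (legendre a p)%:~R = a%:~R ^+ p./2 :> 'F_p.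
Proof.
move=> pp op; rewrite /legendre -intr_Fp_eq0 //.
have p2 := prime_gt1 pp.
have h0 : (p./2 != 0)%N by lia.
case: eqP => [->|/eqP a0]; first by rewrite expr0n (negbTE h0).
case: ifP => [/existsP[x]|/negbT].
  rewrite -intr_Fp_eq0 // rmorphB rmorphXn /= subr_eq0 => /eqP ax.
  rewrite -ax -exprM mulnC exprM expf_half_sqr //.
  by apply: contraNneq a0 => x0; rewrite -ax x0 expr0n.
rewrite negb_exists => /forallP nsq.
have := expf_half_sqr pp op a0; rewrite -[1 in RHS](expr1n _ 2) => /eqP.
rewrite eqf_sqr => /orP[] /eqP // /(Fp_square_of_exp pp op)[y ey].
by have := nsq y; rewrite -intr_Fp_eq0 // rmorphB rmorphXn /= -ey subrr eqxx.
Qed.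

Lemma legendre_trit (a : int) p : [\/ legendre a p = 0, legendre a p = 1 | legendre a p = -1].
Proof.
rewrite /legendre; case: ifP => _; first exact: Or31.
by case: ifP => _; [exact: Or32 | exact: Or33].
Qed.

(** Lets identities between symbols be checked in ['F_p]: 0, 1 and -1 differ by at most 2, and 2 <
    p. *)
Lemma trit_Fp_inj (p : nat) (x y : int) : prime p -> odd p ->
  [\/ x = 0, x = 1 | x = -1] -> [\/ y = 0, y = 1 | y = -1] ->
  x%:~R = y%:~R :> 'F_p -> x = y.
Proof.
move=> pp op hx hy /eqP; rewrite -subr_eq0 -rmorphB /= intr_Fp_eq0 //.
have p2 := prime_gt1 pp.
have {p2 pp op} : (2 < p)%N by lia.
by case: hx => ->; case: hy => -> //; rewrite dvdzE /= => h /dvdn_leq; lia.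
Qed.

Lemma trit_mul (x y : int) :
  [\/ x = 0, x = 1 | x = -1] -> [\/ y = 0, y = 1 | y = -1] ->
  [\/ x * y = 0, x * y = 1 | x * y = -1].
Proof.
by case=> ->; case=> ->; rewrite ?mul0r ?mulr0 ?mul1r ?mulr1 ?mulrNN ?mulr1;
  (exact: Or31 || exact: Or32 || exact: Or33).
Qed.

Lemma legendre_mul (p : nat) (a b : int) : prime p -> odd p ->
  legendre (a * b) p = legendre a p * legendre b p.
Proof.
move=> pp op; apply: (trit_Fp_inj pp op); first exact: legendre_trit.
  by apply: trit_mul; exact: legendre_trit.
by rewrite rmorphM /= !legendreE // rmorphM /= exprMn.
Qed.

Lemma legendre_mod (p : nat) (a b : int) : prime p -> odd p ->
  (p%:Z %| a - b)%Z -> legendre a p = legendre b p.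
Proof.
move=> pp op; rewrite -intr_Fp_eq0 // rmorphB /= subr_eq0 => /eqP ab.
apply: (trit_Fp_inj pp op); [exact: legendre_trit..|].
by rewrite !legendreE // ab.
Qed.

Lemma signr_trit (n : nat) : [\/ (-1) ^+ n = 0 :> int, (-1) ^+ n = 1 :> int | (-1) ^+ n = -1 :> int].
Proof. by rewrite -signr_odd; case: odd; [exact: Or33|exact: Or32]. Qed.

Lemma legendreN1 (p : nat) : prime p -> odd p -> legendre (-1) p = (-1) ^+ p./2.
Proof.
move=> pp op; apply: (trit_Fp_inj pp op); first exact: legendre_trit.
  exact: signr_trit.
by rewrite legendreE // rmorphN1 rmorphXn /= rmorphN1.
Qed.

Lemma legendre_eq0 (p : nat) (a : int) : (legendre a p == 0) = (p%:Z %| a)%Z.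
Proof. by rewrite /legendre; case: ifP => // _; case: ifP. Qed.

Lemma legendre_neq0_sqr (p : nat) (a : int) : ~~ (p%:Z %| a)%Z -> legendre a p * legendre a p = 1.
Proof. by rewrite /legendre => /negbTE ->; case: ifP. Qed.

(** The absolutely least residues of a, 2a, ..., a(p-1)/2 are, up to sign, a permutation of 1, ...,
    (p-1)/2; comparing products gives a^((p-1)/2). The sign at k is the parity of the quotient of
    2ak by p, odd exactly when the residue of ak exceeds p/2. *)
Lemma gauss_lemma (p a : nat) : prime p -> odd p -> ~~ (p %| a)%N ->
  legendre a%:Z p = (-1) ^+ \sum_(k < p./2) (2 * a * k.+1) %/ p.
Proof.
move=> pp op pa; apply: (trit_Fp_inj pp op).
- exact: legendre_trit.
- exact: signr_trit.
rewrite legendreE // rmorphXn /= rmorphN1.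
have p2 := prime_gt1 pp.
pose r (k : 'I_p./2) := ((a * k.+1) %% p)%N.
(* Absolute value of the absolutely least residue, lowered by one because ordinals start at 0. *)
pose rho k := (if (2 * r k < p)%N then (r k).-1 else (p - r k).-1)%N.
have rP k : (0 < r k < p)%N.
  rewrite ltn_mod (prime_gt0 pp) andbT lt0n; apply/negP => h.
  have : (p %| a * k.+1)%N by [].
  rewrite Euclid_dvdM // (negbTE pa) /= => /dvdn_leq; have := ltn_ord k; lia.
have rhoP k : (rho k < p./2)%N.
  by rewrite /rho; have := rP k; case: ifP => h1 h2; lia.
pose s k : 'I_p./2 := Ordinal (rhoP k).
have qr (k : 'I_p./2) : a%:R * (k.+1)%:R =
   (-1) ^+ ((2 * a * k.+1) %/ p)%N * (s k).+1%:R :> 'F_p.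
  have e : (2 * a * k.+1 = (2 * ((a * k.+1) %/ p)) * p + 2 * r k)%N.
    by rewrite -mulnA [in LHS](divn_eq (a * k.+1) p) -/(r k); nia.
  rewrite -natrM [in LHS](divn_eq (a * k.+1) p) natrD natrM.
  have -> : p%:R = 0 :> 'F_p by apply/eqP; rewrite natr_Fp_eq0.
  rewrite mulr0 add0r -/(r k) e divnMDl ?(prime_gt0 pp) // exprD exprM sqrrN expr1n.
  rewrite expr1n mul1r /= /rho; have := rP k; case: ifP => h1 /andP[h2 h3].
    by rewrite divn_small // expr0 mul1r prednK.
  have -> : ((2 * r k) %/ p = 1)%N.
    by apply/eqP; rewrite eqn_leq -ltnS ltn_divLR ?leq_divRL ?(prime_gt0 pp) //; lia.
  rewrite expr1 mulN1r prednK ?subn_gt0 // natrB; last by lia.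
  by have -> : p%:R = 0 :> 'F_p; [apply/eqP; rewrite natr_Fp_eq0 | rewrite sub0r opprK].
have sgn2 n : ((-1) ^+ n) ^+ 2 = 1 :> 'F_p by rewrite -exprM mulnC exprM sqrrN !expr1n.
have s_inj : injective s.
  move=> i j sij; have ei := qr i; have ej := qr j; rewrite sij in ei.
  have a0 : a%:R != 0 :> 'F_p by rewrite natr_Fp_eq0.
  have : (a%:R * i.+1%:R) ^+ 2 == (a%:R * j.+1%:R) ^+ 2 :> 'F_p.
    by rewrite ei ej !exprMn !sgn2.
  rewrite !exprMn => /eqP /(mulfI (expf_neq0 2 a0)) /eqP; rewrite eqf_sqr => /orP[] /eqP.
    have := ltn_ord i; have := ltn_ord j => h1 h2.
    by move/(natr_Fp_inj pp) => H; apply/ord_inj/succn_inj/H; lia.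
  by move/(natr_Fp_opp_eq pp op (ltn_ord i) (ltn_ord j)).
have fact_neq0 : \prod_(k < p./2) (k.+1)%:R != 0 :> 'F_p.
  apply/prodf_neq0 => k _; rewrite natr_Fp_eq0 //.
  by apply/negP => /dvdn_leq; have := ltn_ord k; lia.
apply: (mulIf fact_neq0); rewrite -prodrXr.
have fs : \prod_(k < p./2) (k.+1)%:R = \prod_(k < p./2) (s k).+1%:R :> 'F_p.
  exact: (reindex_inj s_inj).
have -> : a%:~R ^+ p./2 = \prod_(k < p./2) a%:R :> 'F_p by rewrite prodr_const card_ord.
rewrite [in RHS]fs -big_split /=.
by rewrite -big_split /=; apply: eq_bigr => k _; exact: qr.
Qed.

Lemma legendre_sqr (p : nat) (a : int) : prime p -> odd p ->
  legendre (a ^+ 2) p = (~~ (p%:Z %| a)%Z)%:R.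
Proof.
move=> pp op; rewrite expr2 legendre_mul //.
case: (boolP (p%:Z %| a)%Z) => [|h]; last by rewrite legendre_neq0_sqr.
by rewrite -legendre_eq0 => /eqP ->.
Qed.

(* Replacing [q] by [(q + p) / 2] turns Gauss's exponent into Eisenstein's. *)
Lemma legendre_double (p q : nat) : prime p -> odd p -> odd q -> ~~ (p %| q)%N ->
  legendre 2 p * legendre q%:Z p =
    (-1) ^+ (\sum_(k < p./2) k.+1 + \sum_(k < p./2) (q * k.+1) %/ p)%N.
Proof.
move=> pp op oq pq; set c := ((q + p)./2)%N.
have c2 : (2 * c = q + p)%N by rewrite /c; lia.
have p2 : ~~ (p %| 2)%N.
  by apply/negP => /dvdn_leq; have := prime_gt1 pp; lia.
have pc : ~~ (p %| c)%N.
  apply: contra pq => pc; have : (p %| 2 * c)%N by rewrite dvdn_mull.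
  by rewrite c2 dvdn_addl // dvdnn.
rewrite -legendre_mul //.
(* Modulo [p], 2q is 2(q + p) = 4c, and the square 4 has symbol 1. *)
have -> : legendre (2 * q%:Z) p = legendre (2 ^+ 2 * c%:Z) p.
  apply: legendre_mod => //; apply/dvdzP; exists (-2).
  by rewrite expr2; lia.
rewrite legendre_mul // legendre_sqr // dvdzE /= p2 mul1r gauss_lemma // -big_split /=.
congr (_ ^+ _); apply: eq_bigr => k _.
by rewrite c2 mulnDl addnC [(p * _)%N]mulnC divnMDl ?prime_gt0.
Qed.

(** The case q = 1 of [legendre_double], where all quotients by [p] vanish. *)
Lemma legendre2 (p : nat) : prime p -> odd p ->
  legendre 2 p = (-1) ^+ \sum_(k < p./2) k.+1.
Proof.
move=> pp op; have p1 : ~~ (p %| 1)%N by rewrite dvdn1; have := prime_gt1 pp; lia.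
have := @legendre_double p 1 pp op isT p1.
have -> : legendre 1%:Z p = 1.
  by have := @legendre_sqr p 1 pp op; rewrite expr1n dvdzE /= p1.
rewrite mulr1 [X in (_ + X)%N]big1 ?addn0 // => k _.
by rewrite mul1n divn_small //; have := ltn_ord k; lia.
Qed.

Lemma eisenstein_lemma (p q : nat) : prime p -> odd p -> odd q -> ~~ (p %| q)%N ->
  legendre q%:Z p = (-1) ^+ \sum_(k < p./2) (q * k.+1) %/ p.
Proof.
move=> pp op oq pq; have := legendre_double pp op oq pq.
rewrite exprD -legendre2 //; apply: mulfI.
rewrite legendre_eq0 dvdzE /=; apply/negP => /dvdn_leq; have := prime_gt1 pp; lia.
Qed.

Lemma sum_ltn_ord (J n : nat) : (\sum_(j < J) (j < n) = minn J n)%N.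
Proof.
elim: J => [|J IH]; first by rewrite big_ord0 min0n.
by rewrite big_ord_recr /= IH; case: ltnP => /=; lia.
Qed.

Lemma divn_count (J n d : nat) : (0 < d)%N -> (n %/ d <= J)%N ->
  (n %/ d = \sum_(j < J) (j.+1 * d <= n))%N.
Proof.
move=> d0 nJ; rewrite -[LHS](minn_idPr nJ) -sum_ltn_ord.
by apply: eq_bigr => j _; rewrite leq_divRL.
Qed.

(** Eisenstein's count: the sums count the points of a p./2 by q./2 grid on either side of the
    diagonal, and coprimality keeps the diagonal free of points. *)
Lemma lattice_count (p q : nat) : odd p -> odd q -> coprime p q ->
  (\sum_(k < p./2) (q * k.+1) %/ p + \sum_(j < q./2) (p * j.+1) %/ q
    = p./2 * q./2)%N.
Proof.
move=> op oq pq.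
have bnd r s (k : 'I_r./2) : odd r -> odd s -> ((s * k.+1) %/ r <= s./2)%N.
  move=> oR oS; rewrite -ltnS ltn_divLR; last by lia.
  have := half_pred_odd oR; have := half_pred_odd oS; have := ltn_ord k.
  by move: (s./2) (r./2) (nat_of_ord k) => a b c h -> ->; nia.
under eq_bigr => k _ do rewrite (@divn_count q./2) ?bnd ?odd_gt0 //.
under [X in (_ + X)%N]eq_bigr => k _ do rewrite (@divn_count p./2) ?bnd ?odd_gt0 //.
rewrite [X in (_ + X)%N]exchange_big /= -big_split /=.
under eq_bigr => k _.
  rewrite -big_split /=.
  under eq_bigr => j _.
    have -> : ((j.+1 * p <= q * k.+1)%N + (k.+1 * q <= p * j.+1)%N = 1)%N.
      rewrite [(j.+1 * p)%N]mulnC [(k.+1 * q)%N]mulnC.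
      case: (ltngtP (p * j.+1)%N (q * k.+1)%N) => // e.
      have : (p %| q * k.+1)%N by rewrite -e dvdn_mulr.
      rewrite Gauss_dvdr // => /dvdn_leq; have := ltn_ord k; lia.
    over.
  rewrite sum_nat_const card_ord muln1.
  over.
by rewrite sum_nat_const card_ord.
Qed.

Lemma quadratic_reciprocity (p q : nat) : prime p -> prime q -> odd p -> odd q ->
  legendre p%:Z q = legendre q%:Z p * (-1) ^+ (p./2 * q./2)%N.
Proof.
move=> pp pq op oq; case: (eqVneq p q) => [->|npq].
  by have /eqP -> : legendre q%:Z q == 0; rewrite ?mul0r // legendre_eq0 dvdzE /=.
have n1 : ~~ (p %| q)%N by rewrite dvdn_prime2.
have n2 : ~~ (q %| p)%N by rewrite dvdn_prime2 // eq_sym.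
rewrite !eisenstein_lemma // -lattice_count // ?prime_coprime //.
by rewrite exprD mulrA -expr2 -!exprM mulnC exprM sqrrN !expr1n mul1r.
Qed.

(** * Jacobi symbols: multiplicativity, reciprocity and supplementary laws *)

Lemma jacobi_widen (a : int) (l N : nat) : (0 < l)%N -> (l < N)%N ->
  jacobi a l = \prod_(0 <= q < N) legendre a q ^+ logn q l.
Proof.
move=> l0 lN; rewrite /jacobi prime_decompE big_map /=.
rewrite [RHS](bigID (fun q => q \in primes l)) /= [X in _ = _ * X]big1 ?mulr1; last first.
  by move=> q; rewrite -logn_gt0 lt0n negbK => /eqP ->.
rewrite -[RHS]big_filter; apply: perm_big; apply: uniq_perm.
- exact: primes_uniq.
- by rewrite filter_uniq // iota_uniq.
move=> q; rewrite mem_filter mem_index_iota; case: (boolP (q \in primes l)) => //=.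
by rewrite mem_primes => /and3P[_ _ /dvdn_leq]; lia.
Qed.

(** Over a common range of [q], this is additivity of the exponents [logn q]. *)
Lemma jacobi_mulr (a : int) (k l : nat) : (0 < k)%N -> (0 < l)%N ->
  jacobi a (k * l) = jacobi a k * jacobi a l.
Proof.
move=> k0 l0; set N := (k * l).+1.
rewrite !(@jacobi_widen a _ N) ?muln_gt0 ?k0 //; [|rewrite /N; nia..].
by rewrite -big_split /=; apply: eq_bigr => q _; rewrite lognM // exprD.
Qed.

Lemma jacobi1 (a : int) : jacobi a 1 = 1.
Proof. by rewrite /jacobi big_nil. Qed.

Lemma jacobi_prime (a : int) (p : nat) : prime p -> jacobi a p = legendre a p.
Proof.
by move=> pp; rewrite /jacobi prime_decompE primes_prime //= big_seq1 /= logn_prime // eqxx expr1.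
Qed.

Lemma prime_mul_ind (P : nat -> Prop) : P 1%N ->
  (forall p l, prime p -> (0 < l)%N -> P l -> P (p * l)%N) ->
  forall l, (0 < l)%N -> P l.
Proof.
move=> P1 PM; elim/ltn_ind => l IH l0; case: (ltngtP l 1) => [| l1 |-> //]; first by lia.
have pl := pdiv_prime l1; have dl := pdiv_dvd l.
rewrite -(divnK dl) mulnC; have q0 : (0 < l %/ pdiv l)%N by rewrite divn_gt0 ?prime_gt0 // dvdn_leq.
by apply: PM => //; apply: IH => //; rewrite ltn_Pdiv ?prime_gt1.
Qed.

Lemma odd_prime_mul_ind (P : nat -> Prop) : P 1%N ->
  (forall p l, prime p -> odd p -> odd l -> P l -> P (p * l)%N) ->
  forall l, odd l -> P l.
Proof.
move=> P1 PM l ol; have l0 := odd_gt0 ol; move: l l0 ol.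
apply: prime_mul_ind => // p l pp l0 IH; rewrite oddM => /andP[op ol].
exact/PM/IH.
Qed.

(** Reduces an identity of Jacobi symbols to Legendre symbols at odd primes, as both sides are
    completely multiplicative on odd numbers. *)
Lemma jacobi_unique (a : int) (F : nat -> int) : F 1%N = 1 ->
  (forall k l, odd k -> odd l -> F (k * l)%N = F k * F l) ->
  (forall p, prime p -> odd p -> F p = legendre a p) ->
  forall l, odd l -> jacobi a l = F l.
Proof.
move=> F1 FM Fp; apply: odd_prime_mul_ind => [|p l pp op ol IH]; first by rewrite jacobi1.
have p0 := prime_gt0 pp; have l0 := odd_gt0 ol.
by rewrite jacobi_mulr // jacobi_prime // FM // IH (Fp p).
Qed.

Lemma jacobi_mull (a b : int) (l : nat) : odd l ->
  jacobi (a * b) l = jacobi a l * jacobi b l.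
Proof.
move: l; apply: jacobi_unique => [|k l ok ol|p pp op].
- by rewrite !jacobi1.
- by rewrite !jacobi_mulr ?odd_gt0 // mulrACA.
- by rewrite /= !jacobi_prime // legendre_mul.
Qed.

Lemma jacobi_sqr (u l : nat) : odd l -> jacobi (u%:Z ^+ 2) l = (coprime u l)%:R.
Proof.
move: l; apply: jacobi_unique => [|k l ok ol|p pp op].
- by rewrite coprimen1.
- by rewrite coprimeMr -natrM mulnb.
- by rewrite legendre_sqr // dvdzE /= coprime_sym prime_coprime.
Qed.

(** For odd [k] and [l], (kl-1)/2 and (k-1)/2 + (l-1)/2 differ by an even number. *)
Lemma signr_half_mul (k l n : nat) : odd k -> odd l ->
  (-1) ^+ ((k * l)./2 * n)%N = (-1) ^+ (k./2 * n)%N * (-1) ^+ (l./2 * n)%N :> int.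
Proof.
move=> ok ol; rewrite -exprD -mulnDl -[LHS]signr_odd -[RHS]signr_odd !oddM.
congr (_ ^+ (nat_of_bool (_ && _))).
have := half_pred_odd ok; have := half_pred_odd ol.
move: (k./2) (l./2) => x y -> ->.
have -> : ((x.*2.+1 * y.*2.+1)./2 = x + y + (x * y).*2)%N by nia.
by rewrite oddD odd_double addbF.
Qed.

Lemma jacobiN1 (l : nat) : odd l -> jacobi (-1) l = (-1) ^+ l./2.
Proof.
move: l; apply: jacobi_unique => [//|k l ok ol|p pp op].
  by have := signr_half_mul 1 ok ol; rewrite !muln1.
by rewrite legendreN1.
Qed.

Lemma jacobi_recip (q l : nat) : prime q -> odd q -> odd l ->
  jacobi q%:Z l = legendre l%:Z q * (-1) ^+ (l./2 * q./2)%N.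
Proof.
move=> pq oq; move: l; apply: jacobi_unique => [|k l ok ol|p pp op].
- have := @legendre_sqr q 1 pq oq; rewrite expr1n dvdzE /= dvdn1 => ->.
  by have := prime_gt1 pq; case: q {pq oq} => [|[|]].
- by rewrite PoszM legendre_mul // signr_half_mul // mulrACA.
- rewrite [legendre p%:Z q]quadratic_reciprocity // -mulrA -expr2 -exprM muln2.
  by rewrite -signr_odd odd_double mulr1.
Qed.

Lemma odd_sqr (l : nat) : odd l -> exists t, (l ^ 2 = 8 * t + 1)%N.
Proof.
move=> /half_pred_odd; move: l./2 => h ->; exists (h * h.+1)./2.
have := odd_double_half (h * h.+1); rewrite oddM /= andbN add0n -muln2 => e.
by rewrite -mulnn; nia.
Qed.

Lemma sum_succn (h : nat) : (8 * \sum_(k < h) k.+1 = (h.*2.+1 ^ 2).-1)%N.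
Proof.
elim: h => [|h IH]; first by rewrite big_ord0.
by rewrite big_ord_recr /= mulnDr IH -!mulnn; nia.
Qed.

Lemma jacobi2 (l : nat) : odd l -> jacobi 2 l = (-1) ^+ ((l ^ 2).-1 %/ 8)%N.
Proof.
move: l; apply: jacobi_unique => [//|k l ok ol|p pp op].
  (* With squares 8s + 1 and 8t + 1, the exponent of the product is 8st + s + t, of the parity of s
     + t. *)
  have [s es] := odd_sqr ok; have [t et] := odd_sqr ol.
  rewrite expnMn es et.
  have -> : (((8 * s + 1) * (8 * t + 1)).-1 = (8 * (s * t) + s + t) * 8)%N by nia.
  rewrite !addn1 /= mulnK // !mulKn //.
  rewrite -exprD -[LHS]signr_odd -[RHS]signr_odd; congr (_ ^+ (nat_of_bool _)); lia.
by have := sum_succn p./2; rewrite -half_pred_odd // => <-; rewrite mulKn // legendre2.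
Qed.

(** Congruence modulo [M] up to sign, within the naturals: the first case serves periodicity, the
    second the reflection of the character. *)
Definition congr_pm (M k l : nat) : Prop := k = l %[mod M] \/ (M %| k + l)%N.

Lemma congr_pm_dvd (d M k l : nat) : (d %| M)%N -> congr_pm M k l -> congr_pm d k l.
Proof.
move=> dM [e|h]; [left|right; exact: dvdn_trans h].
by rewrite -(modn_dvdm k dM) e modn_dvdm.
Qed.

Lemma eqn_mod_ex (M k l : nat) : k = l %[mod M] -> exists x y, (k + M * x = l + M * y)%N.
Proof.
move=> e; exists (l %/ M)%N, (k %/ M)%N.
by rewrite {1}(divn_eq k M) {2}(divn_eq l M) e; lia.
Qed.

(** Induction over the prime factors of [a]: an odd prime goes through reciprocity, the prime 2
    through the squares of [k] and [l] modulo 16. *)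
Lemma jacobi_congr_pm (a k l : nat) : (0 < a)%N -> odd k -> odd l ->
  congr_pm (4 * a) k l -> jacobi a%:Z k = jacobi a%:Z l.
Proof.
move=> a0 ok ol; move: a a0.
apply: prime_mul_ind => [_|p a pp a0 IH h].
  have J1 n : odd n -> jacobi 1%:Z n = 1.
    by move=> on; have := jacobi_sqr 1 on; rewrite expr1n coprime1n.
  by rewrite !J1.
rewrite PoszM !jacobi_mull // IH; last by apply: congr_pm_dvd h; rewrite dvdn_mul // dvdn_mull.
congr (_ * _); have {}h : congr_pm (4 * p) k l.
  by apply: congr_pm_dvd h; rewrite dvdn_mul // dvdn_mulr.
have [op|ep] := boolP (odd p).
  rewrite !jacobi_recip //; case: h => [/eqn_mod_ex[x [y e]]|/dvdnP[x e]].
    congr (_ * _).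
      apply: legendre_mod => //; apply/dvdzP; exists (4 * (y%:Z - x%:Z)); lia.
    rewrite -[LHS]signr_odd -[RHS]signr_odd !oddM; congr (_ ^+ (nat_of_bool (_ && _))).
    lia.
  (* For k = -l the symbol of -1 modulo [p] appears; it is absorbed by the reciprocity sign, since
     k./2 and l./2 have opposite parity. *)
  have -> : legendre k%:Z p = legendre (-1 * l%:Z) p.
    apply: legendre_mod => //; apply/dvdzP; exists (4 * x%:Z); lia.
  rewrite legendre_mul // legendreN1 // mulrAC [RHS]mulrC; congr (_ * _).
  rewrite -exprD -[LHS]signr_odd -[RHS]signr_odd; congr (_ ^+ (nat_of_bool _)).
  rewrite oddD !oddM; have -> : odd k./2 = ~~ odd l./2 by lia.
  by case: odd; case: odd.
have -> : p = 2 by case: (even_prime pp) ep => // ->.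
have {}h : congr_pm 8 k l.
  by apply: congr_pm_dvd h; case: (even_prime pp) ep => [->|->].
rewrite !jacobi2 //.
have [s es] := odd_sqr ok; have [t et] := odd_sqr ol.
rewrite es et !addn1 /= !mulKn //.
rewrite -[LHS]signr_odd -[RHS]signr_odd; congr (_ ^+ (nat_of_bool _)).
case: h => [/eqn_mod_ex[x [y e]]|/dvdnP[x e]].
  have : (s + 2 * (x * k + 4 * x * x) = t + 2 * (y * l + 4 * y * y))%N.
    move: es et; rewrite -!mulnn; nia.
  by lia.
have : (s + 2 * (x * l) = t + 8 * x * x)%N.
  have : (k = x * 8 - l)%N by lia.
  move: es et; rewrite -!mulnn; nia.
lia.
Qed.

(** * Partial fractions of the cotangent *)

Section Cotangent.
Variable R : realType.
Implicit Types x y z w : R.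

Lemma cvgn_dist_le (f e : nat -> R) (l : R) :
  (\forall n \near \oo, `|l - f n| <= e n) -> e @ \oo --> 0 -> f @ \oo --> l.
Proof.
move=> fe e0; apply/cvgrPdist_le => eps eps0.
have /cvgrPdist_le/(_ _ eps0) := e0; move: fe; apply: filterS2 => n h1 h2.
by apply: (le_trans h1); move: h2; rewrite sub0r normrN; apply: le_trans; exact: ler_norm.
Qed.

Lemma norm_sin_le x : `|sin x| <= `|x|.
Proof.
wlog x0 : x / 0 <= x.
  by move=> W; have [/W//|/ltW x0] := leP 0 x; rewrite -normrN -sinN -[leRHS]normrN W // oppr_ge0.
have [c _] := @MVT_segment R sin cos 0 x x0
  (fun y _ => is_derive_sin y) (continuous_subspaceT (@continuous_sin R)).
rewrite sin0 !subr0 => ->; rewrite normrM -[leRHS]mul1r ler_wpM2r //; exact: cos_max.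
Qed.

Lemma sin_le x : 0 <= x -> sin x <= x.
Proof. by move=> x0; rewrite -{2}(ger0_norm x0) (le_trans (ler_norm _)) // norm_sin_le. Qed.

(** The function sin y - y cos y vanishes at 0 and has derivative y sin y, nonnegative on
    [0, pi]. *)
Lemma mul_cos_le_sin x : 0 <= x <= pi -> x * cos x <= sin x.
Proof.
move=> /andP[x0 xpi].
pose f (y : R) := sin y - y * cos y; pose df (y : R) := y * sin y.
have fd y : is_derive y 1 f (df y).
  by apply: is_derive_eq; rewrite /df /GRing.scale /=; ring.
have fc : {within `[0, x], continuous f}.
  by apply: continuous_subspaceT => y; apply: differentiable_continuous;
    apply/derivable1_diffP; exact: ex_derive.
have [c] := MVT_segment x0 (fun y _ => fd y) fc.
rewrite in_itv /= => /andP[c0 cx]; rewrite /f sin0 mul0r !subr0 => e.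
rewrite -subr_ge0 e mulr_ge0 // mulr_ge0 // sin_ge0_pi // c0 /=.
exact: le_trans xpi.
Qed.

(** By [mul_cos_le_sin] at x/2, sin x is at least x cos(x/2)^2, and cos(x/2)^2 is at least 1/2
    because cos x is nonnegative. *)
Lemma half_le_sin x : 0 <= x <= pi / 2 -> x / 2 <= sin x.
Proof.
move=> /andP[x0 xpi]; have p0 := pi_gt0 R.
have x2 : (x / 2) *+ 2 = x by rewrite mulr2n -splitr.
rewrite -{2}x2.
rewrite sin_mulr2n.
have h1 : x / 2 * cos (x / 2) <= sin (x / 2) by apply: mul_cos_le_sin; lra.
have h2 : 0 <= cos (x / 2) by apply: cos_ge0_pihalf; lra.
have h3 : 0 <= cos ((x / 2) *+ 2).
  by apply: cos_ge0_pihalf; rewrite x2; lra.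
rewrite cos_mulr2n in h3.
nra.
Qed.

Definition cot x := cos x / sin x.

Lemma cotDpi x : cot (x + pi) = cot x.
Proof. by rewrite /cot sinDpi cosDpi invrN mulrNN. Qed.

Lemma cotN x : cot (- x) = - cot x.
Proof. by rewrite /cot sinN cosN invrN mulrN. Qed.

(* No side condition: at a pole of any of the terms, all three are 0. *)
Lemma cot_double x : 2 * cot (2 * x) = cot x + cot (x + pi / 2).
Proof.
rewrite /cot sinDpihalf cosDpihalf (mulr_natl x 2) sin_mulr2n cos_mulr2n.
have [->|s0] := eqVneq (sin x) 0; first by rewrite mulr0 mul0rn !invr0 !mulr0 oppr0 mul0r addr0.
have [->|c0] := eqVneq (cos x) 0; first by rewrite mul0r mul0rn !invr0 !mulr0 mul0r addr0.
have := cos2Dsin2 x => e; have -> : cos x ^+ 2 *+ 2 - 1 = cos x ^+ 2 - sin x ^+ 2 by rewrite -e; ring.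
by rewrite -[(_ * _) *+ 2]mulr_natl; field; rewrite s0 c0.
Qed.

Lemma sum_double (F : nat -> R) N :
  \sum_(0 <= k < N + N) F k = \sum_(0 <= k < N) F k + \sum_(0 <= k < N) F (k + N)%N.
Proof.
rewrite (big_cat_nat _ (n := N)) ?leq_addr //=; congr (_ + _).
by rewrite -{1}[N]add0n big_addn addnK.
Qed.

Lemma cot_sum_pow2 n x :
  2 ^+ n * cot x = \sum_(0 <= k < 2 ^ n) cot ((x + k%:R * pi) / 2 ^+ n).
Proof.
elim: n x => [|n IH] x; first by rewrite expn0 big_nat1 !expr0 mul0r addr0 divr1 mul1r.
rewrite exprS -mulrA IH mulr_sumr expnS mul2n -addnn sum_double -big_split /=; apply: eq_big_nat => k _.
have N0 : 2 ^+ n != 0 :> R by rewrite expf_neq0.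
have -> : (x + k%:R * pi) / 2 ^+ n = 2 * ((x + k%:R * pi) / (2 * 2 ^+ n)) by field.
rewrite cot_double; congr (_ + cot _).
by rewrite natrD natrX; field.
Qed.

(** Moving the upper half of the 2^(n+1) terms down by one period pi places the shifts on both sides
    of 0, so that each scaled term has a limit as n grows. *)
Lemma cot_sum_sym n x :
  cot x = (2 ^+ n.+1)^-1 * \sum_(0 <= k < 2 ^ n)
    (cot ((x + k%:R * pi) / 2 ^+ n.+1) + cot ((x - k.+1%:R * pi) / 2 ^+ n.+1)).
Proof.
have N0 : 2 ^+ n.+1 != 0 :> R by rewrite expf_neq0.
apply: (mulfI N0); rewrite mulVKf // cot_sum_pow2.
rewrite expnS mul2n -addnn sum_double.
rewrite big_split /=; congr (_ + _).
rewrite big_nat_rev /=; apply: eq_big_nat => k /andP[_ kn].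
rewrite -[RHS]cotDpi; congr cot; rewrite add0n natrD natrB // natrX exprS.
have {}N0 : 2 ^+ n != 0 :> R by rewrite expf_neq0.
by field.
Qed.

(** With y = |h n w|, the product y cot y is squeezed between cos y and 1. *)
Lemma cot_cvg (h : nat -> R) w : w != 0 -> (forall n, 0 < h n) -> h @ \oo --> 0 ->
  (fun n => h n * cot (h n * w)) @ \oo --> w^-1.
Proof.
move=> w0 hp h0.
have -> : (fun n => h n * cot (h n * w)) = (fun n => w^-1 * (h n * w * cot (h n * w))).
  by apply/funext => n; field.
rewrite -[X in _ --> X]mulr1; apply: cvgM; first exact: cvg_cst.
have hw0 : (fun n => h n * w) @ \oo --> 0.
  by rewrite -[X in _ --> X](mul0r w); apply: cvgM => //; exact: cvg_cst.
apply: (@squeeze_cvgr _ _ _ _ (fun n => cos (h n * w)) (fun=> 1)); last exact: cvg_cst.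
  have /cvgrPdist_lt/(_ (pi / 2)) := hw0.
  have p0 := pi_gt0 R; move=> /(_ ltac:(lra)).
  apply: filterS => n; rewrite sub0r normrN => hn.
  have y0 : 0 < `|h n * w| by rewrite normr_gt0 mulf_neq0 // gt_eqF.
  have -> : h n * w * cot (h n * w) = `|h n * w| * cot `|h n * w|.
    by case: ger0P => // _; rewrite cotN mulrNN.
  rewrite -cos_norm; move: (`|h n * w|) y0 hn => y y0 hn.
  have s0 : 0 < sin y by apply: sin_gt0_pihalf; rewrite y0.
  have c0 : 0 <= cos y by apply: cos_ge0_pihalf; lra.
  rewrite /cot mulrA ler_pdivlMr // ler_pdivrMr // mul1r mul_cos_le_sin ?andbT; last by lra.
  by rewrite mulrC ler_wpM2r //; apply: sin_le; exact: ltW.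
rewrite -[X in _ --> X]cos0; apply: continuous_cvg => //; exact: continuous_cos.
Qed.

Lemma cotB_le x y : 0 < x <= pi / 2 -> 0 < y <= pi / 2 ->
  `|cot x - cot y| <= 4 * `|x - y| / (x * y).
Proof.
move=> /andP[x0 x1] /andP[y0 y1].
have sx : x / 2 <= sin x by apply: half_le_sin; rewrite ltW.
have sy : y / 2 <= sin y by apply: half_le_sin; rewrite ltW.
have sx0 : 0 < sin x by apply: lt_le_trans sx; rewrite divr_gt0.
have sy0 : 0 < sin y by apply: lt_le_trans sy; rewrite divr_gt0.
have -> : cot x - cot y = sin (y - x) / (sin x * sin y).
  by rewrite /cot sinB; field; rewrite !gt_eqF.
rewrite normrM normfV (gtr0_norm (mulr_gt0 sx0 sy0)).
rewrite ler_pdivrMr ?mulr_gt0 // mulrAC ler_pdivlMr ?mulr_gt0 //.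
have h : x * y <= 4 * (sin x * sin y) by nra.
have := norm_sin_le (y - x); rewrite (distrC y x) => h2.
rewrite (le_trans (ler_wpM2l (normr_ge0 _) h)) // mulrCA -!mulrA [leRHS]mulrA -mulrA.
by rewrite ler_wpM2l // ler_wpM2r // mulr_ge0 // ltW.
Qed.

(** Telescoping: 1/a - 1/(a+1) is at least 1/(a+1)^2 for a > 0. *)
Lemma sum_inv_sqr_le m j :
  \sum_(m.+2 <= k < m.+2 + j) (k%:R ^+ 2)^-1 <= m.+1%:R^-1 - (m.+1 + j)%:R^-1 :> R.
Proof.
elim: j => [|j IH]; first by rewrite !addn0 big_geq // subrr.
rewrite addnS big_nat_recr ?leq_addr //=; apply: (le_trans (lerD IH (lexx _))).
rewrite -addrA lerD2l lerNr opprD opprK.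
have [] : (0 < (m.+1 + j)%:R :> R) /\ (m.+2 + j)%:R = (m.+1 + j)%:R + 1 :> R.
  by rewrite ltr0n; split => //; rewrite natr1.
rewrite addnS; move: (_ + j)%:R => a a0 ->.
rewrite -subr_ge0.
have -> : a^-1 - ((a + 1) ^+ 2)^-1 - (a + 1)^-1 = (a * (a + 1) ^+ 2)^-1.
  have a1 : a != 0 by rewrite gt_eqF.
  have a2 : a + 1 != 0 by rewrite gt_eqF //; lra.
  by field; rewrite ?a1 ?a2.
by rewrite invr_ge0; nra.
Qed.

(** A tail bound uniform in [n], so that the limit in [n] may be taken term by term. The paired
    arguments x + k and k + 1 - x differ by at most 1 and have product at least k^2. *)
Lemma pi_cot_dist x m n h : 0 < x < 1 -> (m.+2 <= 2 ^ n)%N -> h = pi / 2 ^+ n.+1 ->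
  `|pi * cot (pi * x) - \sum_(0 <= k < m.+2)
      (h * cot (h * (x + k%:R)) + h * cot (h * (x - k.+1%:R)))| <= 4 * m.+1%:R^-1.
Proof.
move=> /andP[x0 x1] mn hE.
have N0 : 2 ^+ n != 0 :> R by rewrite expf_neq0.
have N1 : 0 < 2 ^+ n :> R by rewrite exprn_gt0.
have p0 := pi_gt0 R.
have h0 : 0 < h by rewrite hE divr_gt0 // exprn_gt0.
have -> : pi * cot (pi * x) = \sum_(0 <= k < 2 ^ n)
      (h * cot (h * (x + k%:R)) + h * cot (h * (x - k.+1%:R))).
  rewrite (cot_sum_sym n) mulrA -hE mulr_sumr; apply: eq_big_nat => k _.
  by rewrite mulrDr; congr (_ * cot _ + _ * cot _); rewrite hE exprS; field.
rewrite [X in X - _](big_cat_nat _ (n := m.+2)) //= [X in `|X|]addrAC subrr add0r.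
apply: (le_trans (ler_norm_sum _ _ _)).
have : \sum_(m.+2 <= k < 2 ^ n) 4 * (k%:R ^+ 2)^-1 <= 4 * m.+1%:R^-1 :> R.
  rewrite -mulr_sumr ler_wpM2l // -(subnKC mn); apply: (le_trans (sum_inv_sqr_le _ _)).
  by rewrite gerBl invr_ge0.
apply: le_trans; apply: ler_sum_nat => k /andP[mk kn].
have k1 : 1 <= k%:R :> R by rewrite ler1n; lia.
have kN : k%:R + 1 <= 2 ^+ n :> R by rewrite natr1 -natrX ler_nat.
have kS : k.+1%:R = k%:R + 1 :> R by rewrite natr1.
rewrite kS.
(* Since k + 1 <= 2^n, both scaled arguments stay in (0, pi/2], as [cotB_le] requires. *)
have hN : h * 2 ^+ n = pi / 2 by rewrite hE exprS; field.
have A : 0 < h * (x + k%:R) <= pi / 2.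
  by rewrite mulr_gt0 //=; [rewrite -hN ler_pM2l //; lra|lra].
have B : 0 < h * (k%:R + 1 - x) <= pi / 2.
  by rewrite mulr_gt0 //=; [rewrite -hN ler_pM2l //; lra|lra].
have -> : h * (x - (k%:R + 1)) = - (h * (k%:R + 1 - x)) by ring.
rewrite cotN -mulrDr normrM gtr0_norm //.
apply: (le_trans (ler_wpM2l (ltW h0) (cotB_le A B))).
have k0 : k%:R != 0 :> R by rewrite gt_eqF //; lra.
have e1 : x + k%:R != 0 by rewrite gt_eqF //; lra.
have e2 : k%:R + 1 - x != 0 by rewrite gt_eqF //; lra.
rewrite -mulrBr normrM gtr0_norm //.
have -> : h * (4 * (h * `|x + k%:R - (k%:R + 1 - x)|) / (h * (x + k%:R) * (h * (k%:R + 1 - x)))) =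
   4 * (`|x + k%:R - (k%:R + 1 - x)| / ((x + k%:R) * (k%:R + 1 - x))).
  by field; rewrite ?e1 ?e2 ?gt_eqF.
rewrite ler_wpM2l // ler_pdivrMr; last by apply: mulr_gt0; lra.
rewrite mulrC ler_pdivlMr ?exprn_gt0; [|lra..].
have : `|x + k%:R - (k%:R + 1 - x)| <= 1 by rewrite ler_norml; lra.
move: (`|_|) (normr_ge0 (x + k%:R - (k%:R + 1 - x))) => t t0 t1.
have : k%:R ^+ 2 <= (x + k%:R) * (k%:R + 1 - x) by nra.
have : 0 <= k%:R ^+ 2 :> R by apply: sqr_ge0.
move: (k%:R ^+ 2) (_ * (_ - x)) => u v; nra.
Qed.

Lemma cvg_sum_nat (F : nat -> nat -> R) (l : nat -> R) N :
  (forall k, (k < N)%N -> F k @ \oo --> l k) ->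
  (fun n => \sum_(0 <= k < N) F k n) @ \oo --> \sum_(0 <= k < N) l k.
Proof.
elim: N => [|N IH] Fl.
  by rewrite big_geq //; under eq_fun do rewrite big_geq //; exact: cvg_cst.
rewrite big_nat_recr //=; under eq_fun do rewrite big_nat_recr //=.
by apply: cvgD; [apply: IH => k kN; apply: Fl; exact: leqW | exact: Fl].
Qed.

Lemma cvg_pi_pow2 : (fun n => pi / 2 ^+ n.+1 : R) @ \oo --> 0.
Proof.
rewrite (_ : (fun n => _) = geometric (pi / 2) 2^-1).
  by apply: cvg_geometric; rewrite ger0_norm // invf_lt1 // ltr1n.
by apply/funext => n; rewrite /geometric /= exprS exprVn invfM mulrA.
Qed.

Lemma pi_cot_partial x m : 0 < x < 1 ->
  `|pi * cot (pi * x) - \sum_(0 <= k < m.+2) ((x + k%:R)^-1 + (x - k.+1%:R)^-1)|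
    <= 4 * m.+1%:R^-1.
Proof.
move=> x01; have /andP[x0 x1] := x01.
pose S n := \sum_(0 <= k < m.+2) (pi / 2 ^+ n.+1 * cot (pi / 2 ^+ n.+1 * (x + k%:R)) +
   pi / 2 ^+ n.+1 * cot (pi / 2 ^+ n.+1 * (x - k.+1%:R))).
have hp n : 0 < pi / 2 ^+ n.+1 :> R by rewrite divr_gt0 ?pi_gt0 // exprn_gt0.
have Sl : S @ \oo --> \sum_(0 <= k < m.+2) ((x + k%:R)^-1 + (x - k.+1%:R)^-1).
  apply: cvg_sum_nat => k _; apply: cvgD.
    apply: cot_cvg => //; first by rewrite gt_eqF // ltr_wpDr.
    exact: cvg_pi_pow2.
  apply: cot_cvg => //; last exact: cvg_pi_pow2.
  by rewrite lt_eqF // subr_lt0 (lt_le_trans x1) // ler1n.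
have Sl' : (fun n => `|pi * cot (pi * x) - S n|) @ \oo -->
   `|pi * cot (pi * x) - \sum_(0 <= k < m.+2) ((x + k%:R)^-1 + (x - k.+1%:R)^-1)|.
  by apply: cvg_norm; apply: cvgB => //; exact: cvg_cst.
rewrite -(cvg_lim (@Rhausdorff R) Sl'); apply: limr_le; first by apply: cvgP Sl'.
near=> n; apply: pi_cot_dist => //; apply: leq_trans (ltnW (ltn_expl n (isT : 1 < 2)%N)).
by near: n; exact: nbhs_infty_ge.
Unshelve. all: by end_near. Qed.

Lemma pi_cot_cvg x : 0 < x < 1 ->
  (fun K => \sum_(0 <= k < K) ((x + k%:R)^-1 + (x - k.+1%:R)^-1)) @ \oo --> pi * cot (pi * x).
Proof.
move=> x01; rewrite -cvg_shiftS -cvg_shiftS.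
apply: (@cvgn_dist_le _ (fun m => 4 * m.+1%:R^-1)).
  by near=> m; exact: pi_cot_partial.
rewrite -[X in _ --> X](mulr0 4); apply: cvgM; first exact: cvg_cst.
exact: cvg_harmonic.
Unshelve. all: by end_near. Qed.

End Cotangent.

(** * Symmetric sums of periodic functions *)

Section PeriodicSeries.
Variables (R : realType) (g : nat -> R) (M : nat) (eps : R).
Hypotheses (M_gt0 : (0 < M)%N) (g_per : forall l, g (l + M)%N = g l)
  (g_refl : forall l, (l <= M)%N -> g (M - l)%N = eps * g l)
  (g0 : g 0%N = 0) (g_le1 : forall l, `|g l| <= 1) (eps_sign : eps = 1 \/ eps = -1).
Implicit Types z : R.

Definition psum j N : R := \sum_(0 <= l < N) g l * l%:R ^- j.+1.

(** With [g] extended by g(-l) = eps g(l), this is the sum of g(l) / (l - z) over |l| < N. *)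
Definition sym_sum z N : R :=
  \sum_(0 <= l < N) g l * ((l%:R - z)^-1 - eps * (l%:R + z)^-1).

(** The limit of [sym_sum], collected by residue classes modulo [M]. *)
Definition cot_sum z : R :=
  \sum_(0 <= r < M) g r * (M%:R^-1 * (pi * cot (pi * ((r%:R - z) / M%:R)))).

Lemma eps_sqr : eps * eps = 1.
Proof. by case: eps_sign => ->; rewrite ?mulrNN mulr1. Qed.

Lemma g_periodic k l : g (l + k * M)%N = g l.
Proof. by elim: k => [|k IH]; rewrite ?mul0n ?addn0 // mulSn addnCA addnC g_per. Qed.

Lemma sum_nat_refl (F : nat -> R) : F 0%N = 0 -> F M = 0 ->
  \sum_(0 <= r < M) F r = \sum_(0 <= r < M) F (M - r)%N.
Proof.
move=> F0 FM; rewrite !(big_ltn M_gt0) F0 subn0 FM; congr (_ + _).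
by rewrite big_nat_rev /=; apply: eq_big_nat => r _; rewrite add1n subSS.
Qed.

Lemma sum_nat_block (F : nat -> R) K :
  \sum_(0 <= l < K * M) F l = \sum_(0 <= k < K) \sum_(0 <= r < M) F (r + k * M)%N.
Proof.
elim: K => [|K IH]; first by rewrite !big_geq.
rewrite big_nat_recr //= -IH mulSn addnC (big_cat_nat _ (n := (K * M)%N)) ?leq_addr //=.
by congr (_ + _); rewrite -{1}[(K * M)%N]add0n big_addn addKn.
Qed.

(** Reflecting [r] to [M - r] in the terms with l + z gives the negative members of the class of
    [r]; the sign from [g_refl] cancels [eps]. *)
Lemma sym_sum_block z K :
  sym_sum z (K * M) = \sum_(0 <= r < M) g r * \sum_(0 <= k < K)
    ((r%:R - z + k%:R * M%:R)^-1 + (r%:R - z - k.+1%:R * M%:R)^-1).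
Proof.
rewrite /sym_sum sum_nat_block.
under [RHS]eq_bigr do rewrite mulr_sumr.
rewrite [RHS]exchange_big /=; apply: eq_bigr => k _.
under eq_bigr do rewrite g_periodic mulrBr.
rewrite big_split /=; under [RHS]eq_bigr do rewrite mulrDr.
rewrite [RHS]big_split /=; congr (_ + _).
  by apply: eq_bigr => r _; rewrite natrD natrM addrAC.
rewrite sum_nat_refl ?g0 ?mul0r ?oppr0 //; last first.
  by rewrite -[M in g M]add0n g_per g0 mul0r oppr0.
apply: eq_big_nat => r /andP[_ rM]; rewrite g_refl 1?ltnW // mulrACA eps_sqr mul1r.
rewrite -mulrN -invrN; congr (_ * _^-1).
by rewrite natrD natrM natrB 1?ltnW // -natr1; ring.
Qed.

Lemma sym_sum_cvg z : `|z| < 1 -> (fun K => sym_sum z (K * M)) @ \oo --> cot_sum z.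
Proof.
rewrite ltr_norml => /andP[z1 z2]; under eq_fun do rewrite sym_sum_block.
have M0 : 0 < M%:R :> R by rewrite ltr0n.
(* The class of 0 has coefficient 0; it is set apart because only r >= 1 guarantees that x below
   lies in (0, 1). *)
apply: cvg_sum_nat => r rM; case: r rM => [|r] rM.
  by rewrite g0 mul0r; under eq_fun do rewrite mul0r; exact: cvg_cst.
apply: cvgM; first exact: cvg_cst.
set x := (r.+1%:R - z) / M%:R.
have x01 : 0 < x < 1.
  have : 1 <= r.+1%:R :> R by rewrite ler1n.
  have : r.+1%:R + 1 <= M%:R :> R by rewrite natr1 ler_nat.
  by move=> h1 h2; apply/andP; split; rewrite /x; [apply: divr_gt0 => //; lra | rewrite ltr_pdivrMr // mul1r; lra].
have -> : (fun K => \sum_(0 <= k < K) ((r.+1%:R - z + k%:R * M%:R)^-1 +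
     (r.+1%:R - z - k.+1%:R * M%:R)^-1)) =
  (fun K => M%:R^-1 * \sum_(0 <= k < K) ((x + k%:R)^-1 + (x - k.+1%:R)^-1)).
  apply/funext => K; rewrite mulr_sumr; apply: eq_bigr => k _.
  by rewrite mulrDr -!invfM mulrDr mulrBr [M%:R * x]mulrC /x divfK ?gt_eqF // ![M%:R * _]mulrC.
apply: cvgM; first exact: cvg_cst.
exact: pi_cot_cvg.
Qed.

(** Finite geometric sums in z/y with their exact remainder, so that no infinite double sum has to
    be interchanged. *)
Lemma geometric_remainder (y z e : R) n : y != 0 -> y - z != 0 -> y + z != 0 ->
  (y - z)^-1 - e * (y + z)^-1 =
    \sum_(0 <= j < n) (1 - e * (-1) ^+ j) * z ^+ j * y ^- j.+1
    + z ^+ n * y ^- n * ((y - z)^-1 - e * (-1) ^+ n * (y + z)^-1).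
Proof.
move=> y0 y1 y2; elim: n => [|n IH].
  by rewrite big_geq // !expr0 invr1 !mulr1 mul1r add0r.
rewrite big_nat_recr //= -addrA IH; congr (_ + _).
rewrite !exprS; have : y ^+ n != 0 by rewrite expf_neq0.
by move: (y ^+ n) (z ^+ n) ((-1) ^+ n) => p q s p0; field; rewrite y0 y1 y2 p0.
Qed.

Lemma sum_inv_sqr_le2 N : \sum_(0 <= l < N) (l%:R ^+ 2)^-1 <= 2 :> R.
Proof.
have mono : \sum_(0 <= l < N) (l%:R ^+ 2)^-1 <= \sum_(0 <= l < 2 + N) (l%:R ^+ 2)^-1 :> R.
  rewrite [leRHS](big_cat_nat _ (n := N)) ?leq_addl //= lerDl.
  by apply: sumr_ge0 => l _; rewrite invr_ge0 sqr_ge0.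
(* The term at 0 is 0, the inverse of 0 being 0; the term at 1 and the telescoped tail give at most
   1 each. *)
apply: (le_trans mono); rewrite (big_cat_nat _ (n := 2)) ?leq_addr //=.
rewrite big_nat_recr //= big_nat1 expr0n invr0 expr1n invr1 add0r.
rewrite -[leRHS]/(1 + 1) lerD2l; apply: (le_trans (sum_inv_sqr_le R 0 N)).
by rewrite invr1 gerBl invr_ge0.
Qed.

(** The remainder at index l >= 1 is at most 4 |z|^n / l^2, and the 1/l^2 sum to at most 2. The
    bound is uniform in [N]. *)
Lemma sym_sum_psum z n N : `|z| <= 2^-1 -> (0 < n)%N ->
  `|sym_sum z N - \sum_(0 <= j < n) (1 - eps * (-1) ^+ j) * psum j N * z ^+ j|
    <= 8 * `|z| ^+ n.
Proof.
move=> zh n0.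
have -> : \sum_(0 <= j < n) (1 - eps * (-1) ^+ j) * psum j N * z ^+ j =
  \sum_(0 <= l < N) g l * \sum_(0 <= j < n) (1 - eps * (-1) ^+ j) * z ^+ j * l%:R ^- j.+1.
  under [RHS]eq_bigr do rewrite mulr_sumr.
  rewrite [RHS]exchange_big /=; apply: eq_bigr => j _.
  by rewrite mulrAC /psum mulr_sumr; apply: eq_bigr => l _; exact: mulrCA.
rewrite /sym_sum -sumrB; apply: (le_trans (ler_norm_sum _ _ _)).
have : \sum_(0 <= l < N) 4 * `|z| ^+ n * (l%:R ^+ 2)^-1 <= 8 * `|z| ^+ n :> R.
  rewrite -mulr_sumr; apply: (le_trans (ler_wpM2l _ (sum_inv_sqr_le2 N))).
    by rewrite mulr_ge0 // exprn_ge0.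
  by rewrite mulrAC -natrM.
apply: le_trans; apply: ler_sum => -[|l] _.
  by rewrite g0 !mul0r subrr normr0 !mulr_ge0 ?exprn_ge0 // invr_ge0 sqr_ge0.
have l1 : 1 <= l.+1%:R :> R by rewrite ler1n.
move: l1; set y : R := l.+1%:R => y1.
have [z1 z2] : - 2^-1 <= z /\ z <= 2^-1 by move: zh; rewrite ler_norml => /andP[].
have a1 : 0 < y - z by lra.
have a2 : 0 < y + z by lra.
have y0 : 0 < y by lra.
rewrite -mulrBr (@geometric_remainder y z eps n) ?gt_eqF // addrC addKr.
rewrite normrM -[leRHS]mul1r; apply: ler_pM => //.
rewrite normrM normrM normfV !normrX (gtr0_norm y0) -mulrA.
have -> : 4 * `|z| ^+ n / y ^+ 2 = `|z| ^+ n * (y^-1 * (4 / y)).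
  by rewrite expr2 invfM; ring.
apply: ler_wpM2l; first exact: exprn_ge0.
have b1 : (y - z)^-1 <= 2 / y by rewrite ler_pdivlMr // mulrC ler_pdivrMr //; lra.
have b2 : (y + z)^-1 <= 2 / y by rewrite ler_pdivlMr // mulrC ler_pdivrMr //; lra.
have c : `|(y - z)^-1 - eps * (-1) ^+ n * (y + z)^-1| <= 4 / y.
  apply: (le_trans (ler_normB _ _)); rewrite !normrM normrX normrN1 expr1n.
  have -> : `|eps| = 1 by case: eps_sign => ->; rewrite ?normrN1 ?normr1.
  by rewrite !mul1r !gtr0_norm ?invr_gt0 //; apply: (le_trans (lerD b1 b2)); rewrite -mulrDl -natrD.
have d : (y ^+ n)^-1 <= y^-1.
  by rewrite lef_pV2 ?posrE ?exprn_gt0 //; apply: ler_eXnr.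
by apply: ler_pM d c => //; rewrite invr_ge0 exprn_ge0 // ltW.
Qed.

(** At fixed [n] the bound of [sym_sum_psum] passes to the limit along multiples of [M]; it then
    tends to 0 as [n] grows. *)
Lemma pseries_cot_sum (A : nat -> R) z : `|z| <= 2^-1 ->
  (forall j, (fun N => (1 - eps * (-1) ^+ j) * psum j N) @ \oo --> A j) ->
  pseries A z @ \oo --> cot_sum z.
Proof.
move=> zh Acv; rewrite -cvg_shiftS.
apply: (@cvgn_dist_le _ _ (fun n => 8 * `|z| ^+ n.+1)); last first.
  rewrite -[X in _ --> X](mulr0 8); apply: cvgM; first exact: cvg_cst.
  rewrite (cvg_shiftS (fun n => `|z| ^+ n)); apply: cvg_expr.
  by rewrite normr_id; apply: le_lt_trans zh _; rewrite invf_lt1 // ltr1n.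
near=> n.
have z1 : `|z| < 1 by apply: le_lt_trans zh _; rewrite invf_lt1 // ltr1n.
have cv : (fun K => `|sym_sum z (K * M) - \sum_(0 <= j < n.+1) (1 - eps * (-1) ^+ j) * psum j (K * M) * z ^+ j|)
   @ \oo --> `|cot_sum z - pseries A z n.+1|.
  apply: cvg_norm; apply: cvgB; first exact: sym_sum_cvg.
  rewrite /pseries /series /=; apply: cvg_sum_nat => j _; apply: cvgM; last exact: cvg_cst.
  have /(_ j) := Acv; apply: (@cvg_comp _ _ _ (fun K => K * M)%N (fun N => (1 - eps * (-1) ^+ j) * psum j N)).
  apply/cvgnyPge => A0; near=> k; rewrite (leq_trans _ (leq_pmulr _ M_gt0)) //.
  by near: k; exact: nbhs_infty_ge.
rewrite -(cvg_lim (@Rhausdorff R) cv); apply: limr_le; first exact: cvgP cv.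
by near=> K; exact: sym_sum_psum.
Unshelve. all: by end_near. Qed.

Lemma psum_abs_cvg j : (0 < j)%N -> cvgn (psum j).
Proof.
move=> j0; apply: (@normed_cvg _ _ (fun l => g l * l%:R ^- j.+1)).
apply: nondecreasing_is_cvgn.
  by apply: nondecreasing_series => l _ _; exact: normr_ge0.
exists 2 => _ [N _ <-]; apply: (le_trans _ (sum_inv_sqr_le2 N)).
apply: ler_sum => -[|l] _; first by rewrite /= g0 mul0r normr0 expr0n invr0.
have l1 : 1 <= l.+1%:R :> R by rewrite ler1n.
rewrite /= normrM -[leRHS]mul1r; apply: ler_pM => //.
rewrite ger0_norm ?invr_ge0 ?exprn_ge0 // lef_pV2 ?posrE ?exprn_gt0 // ?(lt_le_trans ltr01) //.
by apply: ler_weXn2l.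
Qed.

Lemma cvg_divn d : (0 < d)%N -> (fun n => n %/ d)%N @ \oo --> \oo.
Proof.
move=> d0; apply/cvgnyPge => A; near=> n; rewrite leq_divRL //.
by near: n; exact: nbhs_infty_ge.
Unshelve. all: by end_near. Qed.

(** Convergence may be only conditional here. At multiples of [M] the partial sum is half of
    [sym_sum] at z = 0, which converges; the fewer than [M] remaining terms, each at most 1/(qM),
    add at most 1/q. *)
Lemma psum0_cvg : eps = -1 -> cvgn (psum 0).
Proof.
move=> e1; have h0 : `|0 : R| < 1 by rewrite normr0 ltr01.
pose v K := psum 0 (K * M).
have vS : v @ \oo --> 2^-1 * cot_sum 0.
  have -> : v = (fun K => 2^-1 * sym_sum 0 (K * M)).
    apply/funext => K; rewrite /v /psum /sym_sum mulr_sumr; apply: eq_bigr => l _.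
    by rewrite e1 mulN1r opprK subr0 addr0 expr1; move: (g l) (l%:R^-1) => s t; field.
  by apply: cvgM; [exact: cvg_cst|exact: sym_sum_cvg].
apply/cvg_ex; exists (2^-1 * cot_sum 0).
have -> : psum 0 = (fun N => v (N %/ M)%N + (psum 0 N - v (N %/ M)%N)).
  by apply/funext => N; rewrite addrC subrK.
rewrite -[X in _ --> X]addr0; apply: cvgD.
  exact: (cvg_comp _ _ (cvg_divn M_gt0) vS).
apply: (@cvgn_dist_le _ _ (fun N => (N %/ M)%:R^-1)); last first.
  apply: (cvg_comp _ (fun q => q%:R^-1) (cvg_divn M_gt0)).
  by rewrite -cvg_shiftS; exact: cvg_harmonic.
near=> N; rewrite sub0r normrN /v.
have : (1 <= N %/ M)%N by rewrite leq_divRL // mul1n; near: N; exact: nbhs_infty_ge.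
rewrite /psum (big_cat_nat _ (n := (N %/ M * M)%N)) //=; last exact: leq_trunc_div.
rewrite addrAC subrr add0r; case: (N %/ M)%N (divn_eq N M) (ltn_pmod N M_gt0) => // q Nq rM _ /=.
apply: (le_trans (ler_norm_sum _ _ _)).
have q0 : 0 < q.+1%:R :> R by rewrite ltr0n.
have M0 : 0 < M%:R :> R by rewrite ltr0n.
apply: (@le_trans _ _ (\sum_(q.+1 * M <= l < N) (q.+1%:R * M%:R)^-1)).
  apply: ler_sum_nat => l /andP[ql _].
  have l0 : 0 < l%:R :> R by rewrite ltr0n (leq_trans _ ql) // muln_gt0.
  rewrite normrM -[leRHS]mul1r; apply: ler_pM => //.
  by rewrite expr1 normfV gtr0_norm // lef_pV2 ?posrE ?mulr_gt0 // -natrM ler_nat.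
have cnt : (N - q.+1 * M)%N = (N %% M)%N by rewrite {1}Nq addKn.
rewrite sumr_const_nat cnt -[_ *+ (N %% M)]mulr_natr invfM -mulrA ger_pMr ?invr_gt0 //.
by rewrite mulrC ler_pdivrMr // mul1r ler_nat ltnW.
Unshelve. all: by end_near. Qed.

Lemma psum_cvg j : eps * (-1) ^+ j = -1 -> cvgn (psum j).
Proof.
by case: j => [|j _]; [rewrite mulr1; exact: psum0_cvg | exact: psum_abs_cvg].
Qed.

Lemma pseries_limn_psum z : `|z| <= 2^-1 ->
  pseries (fun j => (1 - eps * (-1) ^+ j) * limn (psum j)) z @ \oo --> cot_sum z.
Proof.
move=> zh; apply: pseries_cot_sum => // j.
(* If the product is 1, the coefficient is 0 and the value of [limn] is immaterial; if it is -1, the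
   partial sums converge. *)
have : eps * (-1) ^+ j = 1 \/ eps * (-1) ^+ j = -1.
  by rewrite -signr_odd; case: eps_sign => ->; case: odd;
    rewrite ?expr1 ?expr0 ?mulrNN ?mulr1 ?mul1r; [right|left|left|right].
case=> [->|e].
  by rewrite subrr mul0r; under eq_fun do rewrite mul0r; exact: cvg_cst.
by apply: cvgM; [exact: cvg_cst | exact: psum_cvg].
Qed.

End PeriodicSeries.

(** * Trigonometric polynomials over the cosine *)

Section TrigPoly.
Variable R : realType.
Implicit Types x y z a : R.

(** For b >= 1 this is 1 + 2 cos y + ... + 2 cos((b-1)y) + cos(by), the trigonometric polynomial
    equal to sin(by) cot(y/2) away from the zeros of sin(y/2). *)
Definition dirichlet (b : nat) y : R :=
  \sum_(0 <= q < b) (cos (q%:R * y) + cos (q.+1%:R * y)).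

Lemma dirichletE b y : sin (b%:R * y) * cos (y / 2) = sin (y / 2) * dirichlet b y.
Proof.
elim: b => [|b IH]; first by rewrite mul0r sin0 mul0r /dirichlet big_geq // mulr0.
rewrite /dirichlet big_nat_recr //= -/(dirichlet b y) mulrDr -IH.
have e2 : b.+1%:R * y = b%:R * y + (y / 2 + y / 2) by rewrite -splitr -natr1 mulrDl mul1r.
rewrite e2 !sinD !cosD !sinD; set s := sin (y / 2); set c := cos (y / 2).
have : s ^+ 2 = 1 - c ^+ 2 by rewrite sin2cos2.
move: (sin _) (cos (b%:R * y)) s c => u v s c e.
have -> : (u * (c * c - s * s) + v * (s * c + c * s)) * c =
  u * c * (c ^+ 2 - s ^+ 2) + 2 * v * s * c ^+ 2 by ring.
have -> : s * (v + (v * (c * c - s * s) - u * (s * c + c * s))) =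
  s * v * (1 + (c ^+ 2 - s ^+ 2)) - 2 * u * c * s ^+ 2 by ring.
by rewrite e; ring.
Qed.

Lemma cos_odd_pihalf r : odd r -> cos (r%:R * (pi / 2)) = 0 :> R.
Proof.
move=> o; rewrite -(odd_double_half r) o natrD mulrDl mul1r addrC cosDpihalf.
have -> : (r./2.*2)%:R * (pi / 2) = pi *+ r./2 :> R.
  by rewrite -muln2 natrM -[pi *+ _]mulr_natl; field.
by elim: r./2 {o} => [|k IH]; rewrite ?mulr0n ?sin0 ?oppr0 // mulrSr sinDpi IH oppr0.
Qed.

(** With y = x - r pi/(2b) and [r] odd, cos(bx) = - sin(by) sin(r pi/2), where the last factor is
    its own inverse. So cos(bx) cancels the pole of the cotangent through [dirichletE]. *)
Lemma cot_cosM b r x : (0 < b)%N -> odd r -> cos (b%:R * x) != 0 ->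
  cot (pi * ((r%:R - 2 * b%:R / pi * x) / (4 * b)%:R)) =
    sin (r%:R * (pi / 2)) *
      ((cos (b%:R * x))^-1 * dirichlet b (x - r%:R * (pi / (2 * b%:R)))).
Proof.
move=> b0 or cx; have p0 : pi != 0 :> R by rewrite gt_eqF ?pi_gt0.
have b1 : b%:R != 0 :> R by rewrite pnatr_eq0 -lt0n.
set y := x - _.
have -> : pi * ((r%:R - 2 * b%:R / pi * x) / (4 * b)%:R) = - (y / 2).
  by rewrite /y natrM; move: (@pi R) p0 => P p0; field; rewrite b1 p0.
have cE : cos (b%:R * x) = - sin (b%:R * y) * sin (r%:R * (pi / 2)).
  have -> : b%:R * x = b%:R * y + r%:R * (pi / 2) by rewrite /y; field.
  by rewrite cosD cos_odd_pihalf // mulr0 sub0r mulNr.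
have ss : sin (r%:R * (pi / 2)) * sin (r%:R * (pi / 2)) = 1 :> R.
  by have := cos2Dsin2 (r%:R * (pi / 2) : R); rewrite cos_odd_pihalf // expr0n add0r expr2.
have sy0 : sin (b%:R * y) != 0.
  by apply: contraNneq cx => e; rewrite cE e oppr0 mul0r.
(* Otherwise [dirichletE] would force cos(y/2) = 0 as well. *)
have sh0 : sin (y / 2) != 0.
  apply/eqP => e; have := dirichletE b y; rewrite e mul0r => /eqP; rewrite mulf_eq0 (negbTE sy0) /=.
  by move=> /eqP e'; have := cos2Dsin2 (y / 2); rewrite e e' expr0n addr0 => /eqP; rewrite eq_sym oner_eq0.
have sr0 : sin (r%:R * (pi / 2)) != 0 :> R.
  by apply/eqP => e; move: ss; rewrite e mulr0 => /eqP; rewrite eq_sym oner_eq0.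
have -> : dirichlet b y = sin (b%:R * y) * cos (y / 2) / sin (y / 2).
  by rewrite dirichletE mulrAC divff // mul1r.
rewrite cotN /cot cE; field; by rewrite ?sy0 ?sh0 ?sr0.
Qed.

(** * Linear combinations of the basic functions *)

Definition in_span (b u : nat) (F : R -> R) : Prop :=
  exists (N : nat) (a : 'I_N -> R) (f : 'I_N -> R -> R),
    (forall i, basic_fun b u (f i)) /\ forall x, F x = \sum_(i < N) a i * f i x.

Lemma in_span_ext b u (F G : R -> R) : (forall x, F x = G x) -> in_span b u F -> in_span b u G.
Proof. by move=> e [N [a [f [fb Fe]]]]; exists N, a, f; split => // x; rewrite -e Fe. Qed.

Lemma in_span0 b u : in_span b u (fun=> 0).
Proof.
exists 0%N, (fun=> 0), (fun _ _ => 0); split; first by case.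
by move=> x; rewrite big_ord0.
Qed.

Lemma in_span_basic b u f : basic_fun b u f -> in_span b u f.
Proof.
by move=> bf; exists 1%N, (fun=> 1), (fun=> f); split => // x; rewrite big_ord1 mul1r.
Qed.

Lemma in_spanD b u (F G : R -> R) :
  in_span b u F -> in_span b u G -> in_span b u (fun x => F x + G x).
Proof.
move=> [N1 [a1 [f1 [b1 e1]]]] [N2 [a2 [f2 [b2 e2]]]].
exists (N1 + N2)%N, (fun i : 'I_(N1 + N2) => match fintype.split i with inl j => a1 j | inr j => a2 j end),
  (fun i : 'I_(N1 + N2) => match fintype.split i with inl j => f1 j | inr j => f2 j end).
split; first by move=> i; case: (fintype.split i).
move=> x; rewrite big_split_ord /= e1 e2; congr (_ + _); apply: eq_bigr => i _.
  by rewrite (unsplitK (inl i)).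
by rewrite (unsplitK (inr i)).
Qed.

Lemma in_spanZ b u (k : R) (F : R -> R) : in_span b u F -> in_span b u (fun x => k * F x).
Proof.
move=> [N [a [f [bf e]]]]; exists N, (fun i => k * a i), f; split => // x.
by rewrite e mulr_sumr; apply: eq_bigr => i _; rewrite mulrA.
Qed.

Lemma in_span_sum b u (I : Type) (s : seq I) (P : pred I) (F : I -> R -> R) :
  (forall i, P i -> in_span b u (F i)) -> in_span b u (fun x => \sum_(i <- s | P i) F i x).
Proof.
move=> H; elim: s => [|i s IH].
  by apply: in_span_ext (in_span0 b u) => x; rewrite big_nil.
have [Pi|Pi] := boolP (P i); last by apply: in_span_ext IH => x; rewrite big_cons (negbTE Pi).
by apply: in_span_ext (in_spanD (H i Pi) IH) => x; rewrite big_cons Pi.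
Qed.

Lemma wgt_neq0 b u t : (0 < u)%N -> (0 < t)%N -> wgt R b u t != 0.
Proof.
move=> u0 t0; rewrite /wgt !mulf_neq0 ?invr_eq0 ?pnatr_eq0 -?lt0n //.
by rewrite /Kc; case: ifP; rewrite ?oner_eq0 ?invr_eq0 ?pnatr_eq0.
Qed.

Section SecMultiples.
Variables (b u t : nat).
Hypotheses (u_gt0 : (0 < u)%N) (t_gt0 : (0 < t)%N) (t_dvd : (t %| u ^ 2)%N).

(** Adding the basic functions with tau = 1 and tau = -1 at p = b - q cancels the sine; the
    coefficient divides out the weight. *)
Lemma in_span_sec_cos q : (q <= b)%N ->
  in_span b u (fun x => sec (b%:R * t%:R * x) * cos (q%:R * t%:R * x)).
Proof.
move=> qb; have w0 := wgt_neq0 b u_gt0 t_gt0.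
pose f (tau : R) x := wgt R b u t * sec (b%:R * t%:R * x)
  * (1 * cos ((b - (b - q))%N%:R * t%:R * x) + tau * sin ((b - q)%N%:R * t%:R * x)).
have f1 tau : tau = 1 \/ tau = -1 -> in_span b u (f tau).
  by move=> ht; apply: in_span_basic; exists 1, tau, (b - q)%N, t; split; auto; rewrite leq_subr.
have := in_spanZ (2 * wgt R b u t)^-1 (in_spanD (f1 1 (or_introl erefl)) (f1 (-1) (or_intror erefl))).
by apply: in_span_ext => x; rewrite /f subKn //; field.
Qed.

Lemma in_span_sec_sin p : (p <= b)%N ->
  in_span b u (fun x => sec (b%:R * t%:R * x) * sin (p%:R * t%:R * x)).
Proof.
move=> pb; have w0 := wgt_neq0 b u_gt0 t_gt0.
pose f (sigma : R) x := wgt R b u t * sec (b%:R * t%:R * x)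
  * (sigma * cos ((b - p)%N%:R * t%:R * x) + 1 * sin (p%:R * t%:R * x)).
have f1 s : s = 1 \/ s = -1 -> in_span b u (f s).
  by move=> hs; apply: in_span_basic; exists s, 1, p, t; split; auto.
have := in_spanZ (2 * wgt R b u t)^-1 (in_spanD (f1 1 (or_introl erefl)) (f1 (-1) (or_intror erefl))).
by apply: in_span_ext => x; rewrite /f; field.
Qed.

Lemma in_span_sec_cosB q a : (q <= b)%N ->
  in_span b u (fun x => sec (b%:R * t%:R * x) * cos (q%:R * (t%:R * x - a))).
Proof.
move=> qb.
have := in_spanD (in_spanZ (cos (q%:R * a)) (in_span_sec_cos qb))
  (in_spanZ (sin (q%:R * a)) (in_span_sec_sin qb)).
by apply: in_span_ext => x; rewrite mulrBr cosB -!mulrA; ring.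
Qed.

Lemma in_span_sec_dirichlet a :
  in_span b u (fun x => sec (b%:R * t%:R * x) * dirichlet b (t%:R * x - a)).
Proof.
(* The range of [q] is repeated as a filter, because [in_span_sum] hands on only the filter. *)
apply: (@in_span_ext _ _ (fun x => \sum_(0 <= q < b | (q < b)%N)
  (sec (b%:R * t%:R * x) * cos (q%:R * (t%:R * x - a))
   + sec (b%:R * t%:R * x) * cos (q.+1%:R * (t%:R * x - a))))).
  move=> x; rewrite /dirichlet mulr_sumr big_nat_cond [RHS]big_nat_cond.
  by apply: eq_big => q; [rewrite -andbA andbb andbT | rewrite [RHS]mulrDr].
by apply: in_span_sum => q qb; apply: in_spanD; apply: in_span_sec_cosB => //; exact: ltnW.
Qed.

End SecMultiples.

(** This is [cot_sum] at z = 2btx/pi with its cotangents of odd index rewritten by [cot_cosM]. *)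
Definition trig_sum (g : nat -> R) (b t : nat) x : R :=
  \sum_(0 <= r < 4 * b) g r * ((4 * b)%:R^-1 * (pi * sin (r%:R * (pi / 2)))) *
  (sec (b%:R * t%:R * x) * dirichlet b (t%:R * x - r%:R * (pi / (2 * b%:R)))).

Lemma trig_sum_in_span g b u t : (0 < u)%N -> (0 < t)%N -> (t %| u ^ 2)%N ->
  in_span b u (trig_sum g b t).
Proof. by move=> u0 t0 tu; apply: in_span_sum => r _; apply/in_spanZ/in_span_sec_dirichlet. Qed.

Lemma cot_sumE g b t x : (0 < b)%N -> (forall r, ~~ odd r -> g r = 0) ->
  cos (b%:R * (t%:R * x)) != 0 ->
  cot_sum g (4 * b) (2 * b%:R / pi * (t%:R * x)) = trig_sum g b t x.
Proof.
move=> b0 geven cx; apply: eq_bigr => r _.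
have [or|er] := boolP (odd r); last by rewrite geven // !mul0r.
by rewrite cot_cosM // -!mulrA.
Qed.

End TrigPoly.

(** * Quadratic characters and generalized Euler numbers *)

Section Assembly.
Variable R : realType.

(** Extension by 0 to even [l] makes the symbol a periodic function on all naturals. *)
Definition chi (a : int) (l : nat) : R := if odd l then (jacobi a l)%:~R else 0.

Lemma chi_even a l : ~~ odd l -> chi a l = 0.
Proof. by rewrite /chi => /negbTE ->. Qed.

Lemma chi_mul a k l : chi a (k * l) = chi a k * chi a l.
Proof.
rewrite /chi oddM; case: (boolP (odd k)) => [ok|]; last by rewrite mul0r.
case: (boolP (odd l)) => [ol|]; last by rewrite mulr0.
by rewrite jacobi_mulr ?odd_gt0 // intrM.
Qed.

Lemma jacobi_trit a l : odd l -> [\/ jacobi a l = 0, jacobi a l = 1 | jacobi a l = -1].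
Proof.
move: l; apply: odd_prime_mul_ind => [|p l pp op ol IH]; first by rewrite jacobi1; exact: Or32.
have p0 := odd_gt0 op; have l0 := odd_gt0 ol.
rewrite jacobi_mulr // jacobi_prime //; apply: trit_mul => //; exact: legendre_trit.
Qed.

Lemma chi_le1 a l : `|chi a l| <= 1.
Proof.
rewrite /chi; case: ifP => [/(jacobi_trit a)|]; last by rewrite normr0.
by case=> ->; rewrite ?normr0 ?normr1 ?rmorphN1 ?normrN1.
Qed.

Lemma chi_mul_sqr a u l : chi (a * u%:Z ^+ 2) l = chi a l * (coprime u l)%:R.
Proof.
rewrite /chi; case: (boolP (odd l)) => [ol|]; last by rewrite mul0r.
by rewrite jacobi_mull // jacobi_sqr // intrM; case: coprime.
Qed.

Lemma jacobi_sign s b l : odd l ->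
  jacobi ((-1) ^+ s * b) l = (-1) ^+ (l./2 * s)%N * jacobi b l.
Proof.
move=> ol; rewrite jacobi_mull //; congr (_ * _).
elim: s => [|s IH]; first by rewrite muln0; have := jacobi_sqr 1 ol; rewrite expr1n coprime1n.
by rewrite exprS jacobi_mull // IH jacobiN1 // mulnS exprD.
Qed.

Lemma chi_periodic s b l : (0 < b)%N ->
  chi ((-1) ^+ s * b%:Z) (l + 4 * b) = chi ((-1) ^+ s * b%:Z) l.
Proof.
move=> b0; rewrite /chi oddD oddM /= addbF; case: (boolP (odd l)) => // ol.
have ol' : odd (l + 4 * b) by rewrite oddD oddM ol.
rewrite !jacobi_sign // (jacobi_congr_pm b0 ol' ol); last by left; rewrite modnDr.
(* The shift changes l./2 by the even number 2b, so the sign contributed by -1 is unchanged. *)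
have -> : ((l + 4 * b)./2 = l./2 + b.*2)%N by lia.
have s1 : (-1) ^+ (b.*2 * s)%N = 1 :> int by rewrite -signr_odd oddM odd_double.
by rewrite mulnDl exprD s1 mulr1.
Qed.

(** The symbol of [b] is even by [jacobi_congr_pm]; each factor -1 changes sign, as the halves of 4b
    - l and l have opposite parity. *)
Lemma chi_reflect s b l : (0 < b)%N -> (l <= 4 * b)%N ->
  chi ((-1) ^+ s * b%:Z) (4 * b - l) = (-1) ^+ s * chi ((-1) ^+ s * b%:Z) l.
Proof.
move=> b0 lb; rewrite /chi oddB // oddM /=; case: (boolP (odd l)) => [ol|]; last by rewrite mulr0.
have ol' : odd (4 * b - l) by rewrite oddB // oddM ol.
rewrite !jacobi_sign // (jacobi_congr_pm b0 ol' ol); last by right; rewrite subnK.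
rewrite !intrM mulrA; congr (_ * _).
have sgn k : ((-1) ^+ k)%:~R = (-1) ^+ k :> R by rewrite rmorphXn /= rmorphN1.
rewrite !sgn -exprD -[LHS]signr_odd -[RHS]signr_odd; congr (_ ^+ (nat_of_bool _)).
rewrite oddD !oddM; have -> : odd (4 * b - l)./2 = ~~ odd l./2 by lia.
by case: odd; case: odd.
Qed.

(** Inclusion-exclusion, one prime at a time: avoiding [p] subtracts from each term its restriction
    to multiples of [p], and the lcm merges the two conditions. *)
Lemma avoid_dvd_decomp (u : nat) (s : seq nat) : all (fun p => p %| u)%N s ->
  exists2 L : seq (R * nat), all (fun e => e.2 %| u)%N L &
    forall l, (all (fun p => ~~ (p %| l)%N) s)%:R = \sum_(e <- L) e.1 * (e.2 %| l)%:R :> R.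
Proof.
elim: s => [_|p s IH /= /andP[pu /IH[L Lu eL]]].
  by exists [:: (1, 1%N)] => [|l]; rewrite /= ?dvd1n // big_seq1 dvd1n mulr1.
exists (L ++ [seq (- e.1, lcmn e.2 p) | e <- L]).
  rewrite all_cat Lu all_map; apply: sub_all Lu => e /= eu.
  by rewrite dvdn_lcm eu.
move=> l; rewrite big_cat big_map /= -eL.
have -> : \sum_(e <- L) - e.1 * (lcmn e.2 p %| l)%:R = - ((p %| l)%:R * \sum_(e <- L) e.1 * (e.2 %| l)%:R) :> R.
  rewrite mulr_sumr -sumrN; apply: eq_bigr => e _.
  by rewrite dvdn_lcm; case: (e.2 %| l)%N; case: (p %| l)%N; rewrite /=; ring.
by rewrite -eL; case: (p %| l)%N; rewrite /= ?mul1r ?mul0r ?subrr ?subr0.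
Qed.

Lemma coprime_decomp (u : nat) : (0 < u)%N ->
  exists L : seq (R * nat), forall l, (0 < l)%N ->
    (coprime u l)%:R = \sum_(e <- L | (e.2 %| u)%N) e.1 * (e.2 %| l)%:R :> R.
Proof.
move=> u0; have [|L Lu eL] := @avoid_dvd_decomp u (primes u).
  by apply/allP => p; rewrite mem_primes => /and3P[].
exists L => l l0; rewrite -big_filter (all_filterP Lu) -eL; congr (nat_of_bool _)%:R.
rewrite coprime_sym coprime_has_primes // -all_predC; apply: eq_in_all => p.
by rewrite mem_primes /= mem_primes l0 => /and3P[-> _ _].
Qed.

Lemma sum_dvd (F : nat -> R) d N : (0 < d)%N ->
  \sum_(0 <= l < N.+1) (d %| l)%:R * F l = \sum_(0 <= k < (N %/ d).+1) F (d * k)%N.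
Proof.
move=> d0; elim: N => [|N IH].
  by rewrite div0n !big_nat1 dvdn0 mul1r muln0.
rewrite big_nat_recr //= IH divnS //; case: (boolP (d %| N.+1)%N) => [dN|_].
  rewrite mul1r add1n [RHS]big_nat_recr //=; congr (_ + F _).
  by rewrite -[LHS](divnK dN) divnS // dN mulnC.
by rewrite mul0r addr0 add0n.
Qed.

Lemma cvg_sum_seq (I : Type) (L : seq I) (P : pred I) (F : I -> nat -> R) (l : I -> R) :
  (forall i, P i -> F i @ \oo --> l i) ->
  (fun n => \sum_(i <- L | P i) F i n) @ \oo --> \sum_(i <- L | P i) l i.
Proof.
move=> Fl; elim: L => [|i L IH].
  by rewrite big_nil; under eq_fun do rewrite big_nil; exact: cvg_cst.
rewrite big_cons; under eq_fun do rewrite big_cons.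
by case: ifP => // Pi; apply: cvgD => //; exact: Fl.
Qed.

(** For l = dk, multiplicativity of [chi] turns the multiples of d into a shorter partial sum for
    [a]. Partial sums are used because convergence may be conditional. *)
Lemma psum_chi_sqr (u : nat) (L : seq (R * nat)) (a : int) j (lam : R) : (0 < u)%N ->
  (forall l, (0 < l)%N ->
    (coprime u l)%:R = \sum_(e <- L | (e.2 %| u)%N) e.1 * (e.2 %| l)%:R :> R) ->
  psum (chi a) j @ \oo --> lam ->
  psum (chi (a * u%:Z ^+ 2)) j @ \oo -->
    \sum_(e <- L | (e.2 %| u)%N) e.1 * (chi a e.2 * e.2%:R ^- j.+1 * lam).
Proof.
move=> u0 eL al; rewrite -cvg_shiftS.
have -> : (fun N => psum (chi (a * u%:Z ^+ 2)) j N.+1) = (fun N => \sum_(e <- L | (e.2 %| u)%N)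
    e.1 * (chi a e.2 * e.2%:R ^- j.+1 * psum (chi a) j (N %/ e.2).+1)).
  apply/funext => N; rewrite /psum.
  transitivity (\sum_(e <- L | (e.2 %| u)%N) \sum_(0 <= l < N.+1)
     e.1 * ((e.2 %| l)%:R * (chi a l * l%:R ^- j.+1))).
    rewrite exchange_big /=; apply: eq_bigr => -[|l] _.
      by rewrite !chi_even // mul0r big1 // => e _; rewrite ?mul0r !mulr0.
    rewrite chi_mul_sqr eL // mulrAC mulrC mulr_suml; apply: eq_bigr => e _.
    by rewrite mulrA.
  apply: eq_bigr => e eu; have e0 := dvdn_gt0 u0 eu.
  rewrite -mulr_sumr sum_dvd //; congr (_ * _); rewrite mulr_sumr; apply: eq_bigr => k _.
  by rewrite chi_mul natrM exprMn invfM mulrACA.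
apply: cvg_sum_seq => e eu; have e0 := dvdn_gt0 u0 eu.
apply: cvgM; first exact: cvg_cst.
apply: cvgM; first exact: cvg_cst.
apply: (cvg_comp _ (fun N => psum (chi a) j N.+1) (cvg_divn e0)).
by rewrite cvg_shiftS.
Qed.

Lemma LserE (a : int) j : Lser R a j.+1 = limn (psum (chi (- a)) j).
Proof.
rewrite /Lser; congr (limn _); apply/funext => -[|N]; first by rewrite /psum !big_geq.
rewrite /psum [RHS]big_ltn // chi_even // mul0r add0r big_mkcond /=.
by apply: eq_bigr => l _; rewrite /chi; case: ifP => //; rewrite mul0r.
Qed.

(** One formula for both parities: the sign (-1)^(n+1) selects the symbol of -m for even [n] and of
    m for odd [n]. *)
Lemma snumE m n : (1 < m)%N -> snum R m n / n`!%:R =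
  (Num.sqrt m%:R)^-1 * (2 * m%:R / pi) ^+ n.+1 * limn (psum (chi ((-1) ^+ n.+1 * m%:Z)) n).
Proof.
move=> m1; have K1 : Kc R m = 1 by rewrite /Kc; case: eqP m1 => // ->.
have f0 : n`!%:R != 0 :> R by rewrite pnatr_eq0 -lt0n fact_gt0.
have pE : (pi / (2 * m%:R)) ^- n.+1 = (2 * m%:R / pi) ^+ n.+1 :> R.
  by rewrite -exprVn invf_div.
rewrite /snum; case: ifP => on.
  have e2 : (n.+1./2.*2 = n.+1)%N by lia.
  rewrite /dnum e2 /= LserE opprK K1 mul1r pE -signr_odd /= on expr0 mul1r.
  by move: (_ ^+ n.+1) (limn _) ((Num.sqrt _)^-1) => A B C; field.
have e2 : (n./2.*2 = n)%N by lia.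
rewrite /cnum e2 /= LserE K1 mul1r pE -signr_odd /= on expr1 mulN1r.
by move: (_ ^+ n.+1) (limn _) ((Num.sqrt _)^-1) => A B C; field.
Qed.

End Assembly.

(** * Generating functions of the twisted L-values and the closed form *)

Section CharacterSeries.
Variables (R : realType) (b : nat).
Hypothesis b_gt0 : (0 < b)%N.

Definition twist (s : nat) : nat -> R := chi R ((-1) ^+ s * b%:Z).

Definition twist_lim (s j : nat) : R := limn (psum (twist s) j).

Lemma sign_cases (s : nat) : (-1) ^+ s = 1 :> R \/ (-1) ^+ s = -1 :> R.
Proof. by rewrite -signr_odd; case: odd; [right|left]. Qed.

Lemma period_gt0 : (0 < 4 * b)%N. Proof. by rewrite muln_gt0. Qed.

(** The sign (-1)^(j+1) (-1)^j is -1, the case where [psum_cvg] also covers j = 0. *)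
Lemma twist_psum_cvg j : psum (twist j.+1) j @ \oo --> twist_lim j.+1 j.
Proof.
apply: (@psum_cvg R (twist j.+1) (4 * b) ((-1) ^+ j.+1)).
- exact: period_gt0.
- by move=> l; exact: chi_periodic.
- by move=> l lM; exact: chi_reflect.
- exact: chi_even.
- exact: chi_le1.
- exact: sign_cases.
- by rewrite exprS -mulrA -expr2 -exprM mulnC exprM sqrrN !expr1n mulr1.
Qed.

Lemma twist_pseries_cvg (s : nat) (z : R) : `|z| <= 2^-1 ->
  pseries (fun j => (1 - (-1) ^+ s * (-1) ^+ j) * twist_lim s j) z @ \oo -->
    cot_sum (twist s) (4 * b) z.
Proof.
apply: (@pseries_limn_psum R (twist s) (4 * b) ((-1) ^+ s)).
- exact: period_gt0.
- by move=> l; exact: chi_periodic.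
- by move=> l lM; exact: chi_reflect.
- exact: chi_even.
- exact: chi_le1.
- exact: sign_cases.
Qed.

Variables (u : nat) (L : seq (R * nat)).
Hypothesis u_gt1 : (1 < u)%N.
Hypothesis coprimeL : forall l, (0 < l)%N ->
  (coprime u l)%:R = \sum_(e <- L | (e.2 %| u)%N) e.1 * (e.2 %| l)%:R :> R.

Let m := (b * u ^ 2)%N.
(** The factor 1/2 offsets 1 - (-1)^s (-1)^n, which is 2 for the surviving twist. *)
Let C : R := (Num.sqrt m%:R)^-1 * 2^-1.

Lemma m_gt1 : (1 < m)%N.
Proof. by rewrite /m -mulnn; nia. Qed.

(* Exactly one of the two twists has the parity of [n]; the other term is 0. *)
Lemma snum_term n (x : R) : snum R m n / n`!%:R * x ^+ n =
  \sum_(e <- L | (e.2 %| u)%N) (C * (e.1 * (2 * m%:R / pi / e.2%:R))) *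
    \sum_(0 <= s < 2) twist s e.2 *
      ((1 - (-1) ^+ s * (-1) ^+ n) * twist_lim s n * (2 * m%:R / pi * x / e.2%:R) ^+ n).
Proof.
have cv := @psum_chi_sqr R u L ((-1) ^+ n.+1 * b%:Z) n _ (ltnW u_gt1) coprimeL (@twist_psum_cvg n).
rewrite snumE ?m_gt1 //.
have -> : (-1) ^+ n.+1 * m%:Z = (-1) ^+ n.+1 * b%:Z * u%:Z ^+ 2.
  by rewrite -mulrA; congr (_ * _); rewrite /m; lia.
rewrite (cvg_lim (@Rhausdorff R) cv) mulr_sumr mulr_suml; apply: eq_bigr => e eu.
have e0 : e.2%:R != 0 :> R by rewrite pnatr_eq0 -lt0n (dvdn_gt0 _ eu) // ltnW.
have -> : \sum_(0 <= s < 2) twist s e.2 *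
      ((1 - (-1) ^+ s * (-1) ^+ n) * twist_lim s n * (2 * m%:R / pi * x / e.2%:R) ^+ n) =
    2 * twist n.+1 e.2 * twist_lim n.+1 n * (2 * m%:R / pi * x / e.2%:R) ^+ n.
  have tw : twist n.+1 = twist (odd n.+1) by rewrite /twist signr_odd.
  have tl : twist_lim n.+1 n = twist_lim (odd n.+1) n by rewrite /twist_lim tw.
  rewrite tl tw big_nat_recr //= big_nat1 -(signr_odd _ n).
  by case: (odd n); rewrite /= ?expr0 ?expr1; ring.
rewrite -/(twist n.+1) /C.
move: (2 * m%:R / pi) (twist_lim _ _) (twist _ _) ((Num.sqrt _)^-1) e0 => A T S D e0.
rewrite !exprMn exprVn !exprS; have : e.2%:R ^+ n != 0 :> R by rewrite expf_neq0.
by move: (_ ^+ n) (A ^+ n) => B B' B0; field; rewrite ?e0 ?B0.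
Qed.

Definition closed_form (x : R) : R :=
  \sum_(e <- L | (e.2 %| u)%N) (C * (e.1 * (2 * m%:R / pi / e.2%:R))) *
    \sum_(0 <= s < 2) twist s e.2 * trig_sum (twist s) b (u ^ 2 %/ e.2) x.

Lemma closed_form_in_span : in_span b u closed_form.
Proof.
apply: in_span_sum => e eu; apply: in_spanZ; apply: in_span_sum => s _; apply: in_spanZ.
have eu2 : (e.2 %| u ^ 2)%N by rewrite -mulnn dvdn_mulr.
have u2 : (0 < u ^ 2)%N by rewrite expn_gt0 (ltnW u_gt1).
apply: trig_sum_in_span; first exact: ltnW.
- by rewrite divn_gt0 ?(dvdn_leq u2 eu2) // (dvdn_gt0 u2 eu2).
- exact: dvdn_div.
Qed.

(** The radius makes |2mx/pi| at most 1/2, hence also after division by any d >= 1, as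
    [twist_pseries_cvg] requires. *)
Lemma pseries_snum_cvg (x : R) : `|x| <= pi / (4 * m%:R) ->
  pseries (fun n => snum R m n / n`!%:R) x @ \oo --> closed_form x.
Proof.
move=> xs.
have m0 : 0 < m%:R :> R by rewrite ltr0n ltnW // m_gt1.
have p0 := pi_gt0 R.
have -> : pseries (fun n => snum R m n / n`!%:R) x =
  (fun N => \sum_(e <- L | (e.2 %| u)%N) (C * (e.1 * (2 * m%:R / pi / e.2%:R))) *
    \sum_(0 <= s < 2) twist s e.2 *
      pseries (fun j => (1 - (-1) ^+ s * (-1) ^+ j) * twist_lim s j) (2 * m%:R / pi * x / e.2%:R) N).
  apply/funext => N; rewrite /pseries /series /=.
  under eq_bigr do rewrite snum_term.
  rewrite exchange_big /=; apply: eq_bigr => e _; rewrite -mulr_sumr; congr (_ * _).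
  by rewrite exchange_big /=; apply: eq_bigr => s _; rewrite mulr_sumr.
apply: cvg_sum_seq => e eu; have e0 : (0 < e.2)%N by rewrite (dvdn_gt0 _ eu) // ltnW.
apply: cvgM; first exact: cvg_cst.
apply: cvg_sum_nat => s _; apply: cvgM; first exact: cvg_cst.
have e1 : 1 <= e.2%:R :> R by rewrite ler1n.
have z1 : `|2 * m%:R / pi * x / e.2%:R| <= 2^-1.
  rewrite normrM normfV [`|e.2%:R|]ger0_norm ?ler0n // ler_pdivrMr ?(lt_le_trans ltr01) //.
  apply: (@le_trans _ _ 2^-1); last by rewrite ler_peMr.
  rewrite normrM gtr0_norm ?divr_gt0 ?mulr_gt0 //.
  apply: (le_trans (ler_wpM2l _ xs)); first by rewrite divr_ge0 ?mulr_ge0 // ltW.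
  by rewrite le_eqVlt; apply/orP; left; apply/eqP; move: (@pi R) p0 => P P0; field; rewrite !gt_eqF.
have eu2 : (e.2 %| u ^ 2)%N by rewrite -mulnn dvdn_mulr.
(* Since m = bu^2, dividing by d leaves the variable of [b] at tx with t = u^2/d. *)
have zE : 2 * m%:R / pi * x / e.2%:R = 2 * b%:R / pi * ((u ^ 2 %/ e.2)%:R * x).
  have -> : (u ^ 2 %/ e.2)%:R = u%:R ^+ 2 / e.2%:R :> R.
    apply: (canRL (mulfK _)); first by rewrite gt_eqF // (lt_le_trans ltr01).
    by rewrite -natrM divnK // natrX.
  rewrite /m natrM natrX; move: (@pi R) p0 => P P0; field.
  by rewrite !gt_eqF // (lt_le_trans ltr01).
rewrite -(@cot_sumE R (twist s) b (u ^ 2 %/ e.2) x b_gt0) -?zE.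
- exact: twist_pseries_cvg.
- exact: chi_even.
(* Here btx = (pi/2) z with |z| <= 1/2, so the cosine is positive. *)
rewrite gt_eqF //; apply: cos_gt0_pihalf.
have -> : b%:R * ((u ^ 2 %/ e.2)%:R * x) = pi / 2 * (2 * m%:R / pi * x / e.2%:R).
  by rewrite zE; move: (@pi R) p0 => P P0; field; rewrite gt_eqF.
move: z1; rewrite ler_norml => /andP[z1 z2]; move: (2 * m%:R / pi * x / e.2%:R) z1 z2 => z z1 z2.
by apply/andP; split; nra.
Qed.

End CharacterSeries.

Theorem theorem3p1 (R : realType) (m b u : nat)
    (b_ge1 : (1 <= b)%N) (b_sqfree : squarefree b) (u_gt1 : (1 < u)%N)
    (m_def : m = (b * u ^ 2)%N) :
  exists (N : nat) (a : 'I_N -> R) (f : 'I_N -> R -> R),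
    (forall i : 'I_N, basic_fun b u (f i)) /\
    \forall x \near (0 : R),
      pseries (fun n : nat => snum R m n / n`!%:R) x @ \oo
        --> \sum_(i < N) a i * f i x.
Proof.
have [L coprimeL] := coprime_decomp R (ltnW u_gt1).
have [N [a [f [fb fE]]]] := @closed_form_in_span R b u L u_gt1.
exists N, a, f; split => //.
have m0 : 0 < m%:R :> R by rewrite ltr0n m_def muln_gt0 b_ge1 expn_gt0 ltnW.
near=> x; rewrite -fE m_def; apply: pseries_snum_cvg => //.
rewrite -m_def -[`|x|]normrN -[- x]add0r; near: x; apply: cvgr_dist_le => //.
by rewrite divr_gt0 ?pi_gt0 // mulr_gt0.
Unshelve. all: by end_near. Qed.
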